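(* Let $\gamma$ be a translation-invariant (nonnull) specification, $\nu\in\mathcal G_{\mathrm{inv}}(\gamma)$, and $\mu\in\mathcal M^+_{1,\mathrm{inv}}$ satisfying Condition C1: $\mu(\Omega^{\le 0}_\gamma)=1$. Then: (1) $h(\mu|\nu)$ exists if and only if $e^+_\nu$ exists, and in that case $$h(\mu|\nu)=-h(\mu)+e^+_\nu-\int_\Omega\log\frac{\gamma_0(\sigma^+|\sigma^+)}{\gamma_0(+|\sigma^+)}\,\mu(d\sigma).$$ (2) If moreover $\mu\in\mathcal G_{\mathrm{inv}}(\gamma)$ and $e^+_\nu$ exists, then the limit $\lim_{n\to\infty}\frac1{|\Lambda_n|}\log\frac{\mu(+_{\Lambda_n})}{\nu(+_{\Lambda_n})}$ exists and equals $h(\mu|\nu)$.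
   Context: Let $E$ be a finite set containing a distinguished element denoted $+1$, and $\Omega=E^{\mathbb Z^d}$ with product topology and Borel $\sigma$-field $\mathcal F$; $\mathcal F_\Lambda$ is the $\sigma$-field of the coordinates in $\Lambda$, $\mathcal S$ the finite subsets of $\mathbb Z^d$, $\sigma_\Lambda\omega_{\Lambda^c}$ the configuration equal to $\sigma$ on $\Lambda$ and $\omega$ off $\Lambda$, and $\mu(\sigma_\Lambda)=\mu(\{\omega:\omega_\Lambda=\sigma_\Lambda\})$. Local functions are $\mathcal F_\Delta$-measurable for some finite $\Delta$. Translations $(\tau_x\omega)(y)=\omega(x+y)$; $\mathcal M^+_{1,\mathrm{inv}}$ = translation-invariant probability measures. A specification $\gamma=(\gamma_\Lambda)_{\Lambda\in\mathcal S}$ is a family of probability kernels $\gamma_\Lambda(\cdot|\omega)$, $\mathcal F_{\Lambda^c}$-measurable in $\omega$, proper ($\gamma_\Lambda(B|\omega)=1_B(\omega)$ for $B\in\mathcal F_{\Lambda^c}$) and consistent ($\int\gamma_\Lambda(A|\omega')\gamma_{\Lambda'}(d\omega'|\omega)=\gamma_{\Lambda'}(A|\omega)$ for $\Lambda\subset\Lambda'$, every $\omega$); it is nonnull: $0<a_\Lambda<\inf_{\sigma,\eta}\gamma_\Lambda(\sigma_\Lambda|\eta)\le\sup_{\sigma,\eta}\gamma_\Lambda(\sigma_\Lambda|\eta)<b_\Lambda<1$, where $\gamma_\Lambda(\sigma_\Lambda|\eta)=\gamma_\Lambda(\{\omega:\omega_\Lambda=\sigma_\Lambda\}|\eta)$;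 translation-invariant means $\gamma_{\Lambda+x}(A|\omega)=\gamma_\Lambda(\tau_xA|\tau_x\omega)$. $\mathcal G(\gamma)$ is the set of probability measures $\mu$ with $\mu(A|\mathcal F_{\Lambda^c})=\gamma_\Lambda(A|\cdot)$ $\mu$-a.s. for all $\Lambda,A$; $\mathcal G_{\mathrm{inv}}(\gamma)=\mathcal G(\gamma)\cap\mathcal M^+_{1,\mathrm{inv}}$. $\omega$ is a point of continuity of $\gamma$ if $\omega'\mapsto\int f\,d\gamma_\Lambda(\cdot|\omega')$ is continuous at $\omega$ for all $\Lambda\in\mathcal S$ and local $f$; $\Omega_\gamma$ is the set of such points. Let $+$ denote the configuration identically $+1$, and $+_\Lambda$ its restriction to $\Lambda$. With $\le$ the lexicographic order on $\mathbb Z^d$, for $\sigma\in\Omega$ let $\sigma^+(x)=\sigma(x)$ if $x\le 0$ and $\sigma^+(x)=+1$ if $x>0$; $\Omega^{\le0}_\gamma=\{\sigma\in\Omega:\sigma^+\in\Omega_\gamma\}$. For $a\in E$ write $\gamma_0(a|\omega)=\gamma_{\{0\}}(\{\omega':\omega'(0)=a\}|\omega)$, and for configurations $\gamma_0(\sigma|\omega)=\gamma_0(\sigma(0)|\omega)$. Let $\Lambda_n=[-n,n]^d\cap\mathbb Z^d$. The $\nu$-specific energy of the plus state is $e^+_\nu=-\lim_{n\to\infty}|\Lambda_n|^{-1}\log\nu(+_{\Lambda_n})$ whenever the limit exists. Relative entropy: $h_\Lambda(\mu|\nu)=\sum_{\sigma_\Lambda}\mu(\sigma_\Lambda)\log\frac{\mu(\sigma_\Lambda)}{\nu(\sigma_\Lambda)}$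 and $h(\mu|\nu)=\lim_n|\Lambda_n|^{-1}h_{\Lambda_n}(\mu|\nu)$ when it exists. Kolmogorov–Sinai entropy: $h(\mu)=-\lim_n|\Lambda_n|^{-1}\sum_{\sigma_{\Lambda_n}}\mu(\sigma_{\Lambda_n})\log\mu(\sigma_{\Lambda_n})$. *)

(* Defs.v *)
From HB Require Import structures.
From mathcomp Require Import all_boot all_order all_algebra.
From mathcomp Require Import all_classical all_reals all_analysis.
From mathcomp Require Import measurable_realfun.
Set Implicit Arguments. Unset Strict Implicit. Unset Printing Implicit Defensive.
Import Order.TTheory GRing.Theory Num.Theory.
Local Open Scope classical_set_scope.
Local Open Scope ring_scope.

Definition site (d : nat) := 'rV[int]_d.

Definition config (d : nat) (E : finType) (pl : E) := site d -> E.
HB.instance Definition _ d (E : finType) (pl : E) :=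
  gen_eqMixin (config d pl).
HB.instance Definition _ d (E : finType) (pl : E) :=
  gen_choiceMixin (config d pl).
HB.instance Definition _ d (E : finType) (pl : E) :=
  isPointed.Build (config d pl) (fun _ => pl).

Definition cylgen d (E : finType) (pl : E) (L : set (site d)) :
  set (set (config d pl)) :=
  [set A | exists x a, L x /\ A = [set w : config d pl | w x = a]].

Definition Omega d (E : finType) (pl : E) :=
  g_sigma_algebraType (@cylgen d E pl setT).

Definition sF d (E : finType) (pl : E) (L : set (site d)) : set (set (Omega d pl)) :=
  <<s @cylgen d E pl L >>.

Definition cyl_on d (E : finType) (pl : E) (L : set (site d)) (s : Omega d pl) :
  set (Omega d pl) := [set w | forall x, L x -> w x = s x].

Definition tau d (E : finType) (pl : E) (x : site d) (w : Omega d pl) : Omega d pl :=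
  fun y => w (x + y).

Definition local_fun d (E : finType) (pl : E) (R : realType) (f : Omega d pl -> R) :=
  exists D : set (site d), finite_set D /\
    forall B : set R, measurable B -> @sF d E pl D (f @^-1` B).

Notation kernel_fam d pl R :=
  (set (site d) -> Omega d pl -> probability (Omega d pl) R).

(* gamma is a nonnull specification; gamma L w A stands for gamma_L(A|w). *)
Definition is_specification d (E : finType) (pl : E) (R : realType)
    (gamma : kernel_fam d pl R) : Prop :=
  (forall L, finite_set L -> forall A, measurable A ->
     forall B : set (\bar R), measurable B ->
       @sF d E pl (~` L) ((fun w => gamma L w A) @^-1` B)) /\
  (forall L, finite_set L -> forall B, @sF d E pl (~` L) B ->
     forall w, gamma L w B = (\1_B w)%:E) /\
  (forall L L', finite_set L -> finite_set L' -> L `<=` L' ->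
     forall A, measurable A -> forall w,
       (\int[gamma L' w]_w' gamma L w' A)%E = gamma L' w A) /\
  (forall L, finite_set L -> L !=set0 ->
     exists a b : R, 0 < a /\ b < 1 /\
       forall s eta : Omega d pl, (a%:E <= gamma L eta (cyl_on L s) <= b%:E)%E).

Definition spec_translation_invariant d (E : finType) (pl : E) (R : realType)
    (gamma : kernel_fam d pl R) : Prop :=
  forall L, finite_set L -> forall (x : site d) A, measurable A -> forall w,
    gamma [set y + x | y in L] w A = gamma L (@tau d E pl x w) (@tau d E pl x @` A).

(* mu in G(gamma): mu(A | F_{L^c}) = gamma_L(A|.) mu-a.s., i.e. (gamma_L(A|.)
   being F_{L^c}-measurable) mu(A /\ B) = int_B gamma_L(A|w) mu(dw) for B in F_{L^c}. *)
Definition is_gibbs d (E : finType) (pl : E) (R : realType)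
    (gamma : kernel_fam d pl R) (mu : probability (Omega d pl) R) : Prop :=
  forall L, finite_set L -> forall A, measurable A ->
    forall B, @sF d E pl (~` L) B ->
      mu (A `&` B) = (\int[mu]_(w in B) gamma L w A)%E.

Definition translation_invariant d (E : finType) (pl : E) (R : realType)
    (mu : probability (Omega d pl) R) : Prop :=
  forall (x : site d) A, measurable A -> mu (@tau d E pl x @^-1` A) = mu A.

(* w is a point of continuity of gamma (product topology on E^{Z^d}, E discrete:
   neighbourhoods of w are generated by {w' | w'_D = w_D}, D finite). *)
Definition cont_point d (E : finType) (pl : E) (R : realType)
    (gamma : kernel_fam d pl R) (w : Omega d pl) : Prop :=
  forall L, finite_set L -> forall f : Omega d pl -> R, local_fun f ->
    forall e : R, 0 < e -> exists D : set (site d), finite_set D /\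
      forall w', (forall y, D y -> w' y = w y) ->
        `| fine (\int[gamma L w']_z (f z)%:E)%E - fine (\int[gamma L w]_z (f z)%:E)%E | < e.

Definition lexlt d (x y : site d) : Prop :=
  exists i : 'I_d, (forall j : 'I_d, (j < i)%N -> x ord0 j = y ord0 j) /\
                   x ord0 i < y ord0 i.

Definition plusify d (E : finType) (pl : E) (s : Omega d pl) : Omega d pl :=
  fun x => if `[< lexlt 0 x >] then pl else s x.

Definition Omega_le0 d (E : finType) (pl : E) (R : realType)
    (gamma : kernel_fam d pl R) : set (Omega d pl) :=
  [set s | cont_point gamma (plusify s)].

(* Lambda_n = [-n,n]^d, indexed by the finite type boxn d n via site_of. *)
Definition boxn (d n : nat) := {ffun 'I_d -> 'I_(2 * n + 1)}.
Definition site_of d n (b : boxn d n) : site d :=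
  \row_i ((nat_of_ord (b i))%:Z - n%:Z).
Definition patcyl d (E : finType) (pl : E) n (s : {ffun boxn d n -> E}) :
  set (Omega d pl) := [set w | forall b, w (site_of b) = s b].
Definition plus_pat d (E : finType) (pl : E) n : {ffun boxn d n -> E} :=
  [ffun => pl].
Definition cardL (R : realType) d n : R := (#|{: boxn d n}|)%:R.

Definition relent_n d (E : finType) (pl : E) (R : realType)
    (mu nu : probability (Omega d pl) R) (n : nat) : R :=
  (cardL R d n)^-1 * \sum_(s : {ffun boxn d n -> E})
     fine (mu (@patcyl d E pl n s)) * ln (fine (mu (@patcyl d E pl n s)) / fine (nu (@patcyl d E pl n s))).

Definition ks_n d (E : finType) (pl : E) (R : realType)
    (mu : probability (Omega d pl) R) (n : nat) : R :=
  - ((cardL R d n)^-1 * \sum_(s : {ffun boxn d n -> E})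
       fine (mu (@patcyl d E pl n s)) * ln (fine (mu (@patcyl d E pl n s)))).

Definition energy_n d (E : finType) (pl : E) (R : realType)
    (nu : probability (Omega d pl) R) (n : nat) : R :=
  - ((cardL R d n)^-1 * ln (fine (nu (@patcyl d E pl n (@plus_pat d E pl n))))).

Definition ratio_n d (E : finType) (pl : E) (R : realType)
    (mu nu : probability (Omega d pl) R) (n : nat) : R :=
  (cardL R d n)^-1 * ln (fine (mu (@patcyl d E pl n (@plus_pat d E pl n))) /
                         fine (nu (@patcyl d E pl n (@plus_pat d E pl n)))).

Definition gamma0 d (E : finType) (pl : E) (R : realType)
    (gamma : kernel_fam d pl R) (a : E) (w : Omega d pl) : R :=
  fine (gamma [set (0 : site d)] w [set w' : Omega d pl | w' 0 = a]).

Definition energy_integrand d (E : finType) (pl : E) (R : realType)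
    (gamma : kernel_fam d pl R) (s : Omega d pl) : R :=
  ln (gamma0 gamma (plusify s 0) (plusify s) / gamma0 gamma pl (plusify s)).

(* Main.v *)
(** Write [Lam n] for the box and order its sites lexicographically.  Changing the
    spins of [sigma] to plus one site at a time, in decreasing order, telescopes
    [ln nu(sigma) - ln nu(+)] over the box into single-site terms.  By the Gibbs
    property the term at [x] is an average of single-site kernels over
    configurations that agree in the box with [sigma] up to [x] and with plus
    after [x], so it differs from the energy integrand at [tau x sigma] by at
    most a constant times the oscillation of [gamma0] on the configurations that
    agree near the origin with the plusified [tau x sigma].  Condition C1 makes
    the [mu]-mean of that oscillation vanish, and sites near the boundary of the
    box are negligible.  Hence [relent_n = - ks_n + energy_n - I_n], where [I_n]
    tends to the integral of the energy integrand.  The same telescoping writes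
    [ks_n] as an average of conditional entropies given the past in the box;
    these decrease with the conditioning set, so [ks_n] converges.  Part (2) is
    part (1) applied to [nu] and to [mu] itself, as [relent_n mu mu = 0]. *)
Require Import Defs.
From HB Require Import structures.
From mathcomp Require Import all_boot all_order all_algebra.
From mathcomp Require Import all_classical all_reals all_analysis.
From mathcomp Require Import measurable_realfun.
From mathcomp Require Import zify ring lra.
Import Order.TTheory GRing.Theory Num.Theory.
Import numFieldNormedType.Exports.
Local Open Scope classical_set_scope.
Local Open Scope ring_scope.

(** * Telescoping sums along a finite total order *)

Section telescoping.
Variables (I : finType) (lt : rel I).
Hypothesis lt_irr : irreflexive lt.
Hypothesis lt_trans : transitive lt.
Hypothesis lt_total : forall x y, x != y -> lt x y || lt y x.

(** An element with the most predecessors inside [S] works: anything above it would have all of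
    these predecessors and the element itself as well. *)
Lemma ex_lt_maximal (S : {set I}) : S != finset.set0 ->
  exists2 m, m \in S & forall y, y \in S -> y != m -> lt y m.
Proof.
move=> /set0Pn[x0 x0S].
pose f x := #|[set y in S | lt y x]%SET|.
have [m mS mmax] := @arg_maxnP _ x0 (mem S) f x0S.
exists m => // y yS ynm.
case/orP: (lt_total y m ynm) => // lmy.
have := mmax y yS; rewrite /= leqNgt => /negP[]; apply: proper_card.
apply/properP; split.
  apply/fintype.subsetP => z; rewrite !inE => /andP[-> lzm] /=.
  exact: lt_trans lmy.
by exists m; rewrite !inE ?lt_irr ?andbF // lmy andbT; exact: mS.
Qed.

(** Each summand compares two consecutive down-closed sets. The induction proves the identity for
    every down-closed [S] by removing its greatest element, which leaves a down-closed set. *)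
Lemma telescope_order (V : zmodType) (G : {set I} -> V) :
  \sum_x (G [set y | ~~ lt x y]%SET - G [set y | lt y x]%SET)
  = G finset.setT - G finset.set0.
Proof.
suff H k : forall S : {set I}, #|S| = k ->
    (forall x y, x \in S -> lt y x -> y \in S) ->
    \sum_(x in S) (G [set y | ~~ lt x y]%SET - G [set y | lt y x]%SET)
      = G S - G finset.set0.
  rewrite -(H _ finset.setT erefl); last by move=> *; rewrite inE.
  by apply: eq_bigl => x; rewrite inE.
elim: k => [|k IH] S.
  by move/eqP; rewrite cards_eq0 => /eqP -> _; rewrite big_set0 subrr.
move=> cS dS.
have S0 : S != finset.set0 by rewrite -card_gt0 cS.
have [m mS mmax] := ex_lt_maximal _ S0.
rewrite (big_setD1 m) //= IH; last first.
- move=> x y; rewrite !inE => /andP[xm xS] lyx.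
  rewrite (dS x y xS lyx) andbT; apply/eqP => ym; subst y.
  by have := lt_trans _ _ _ lyx (mmax _ xS xm); rewrite lt_irr.
- by move: cS; rewrite (cardsD1 m) mS add1n => -[].
have -> : [set y | ~~ lt m y]%SET = S.
  apply/setP => y; rewrite inE; apply/idP/idP.
    move=> nmy; have [-> //|ynm] := eqVneq y m.
    by have := lt_total _ _ ynm; rewrite (negbTE nmy) orbF; exact: dS.
  move=> yS; have [->|ynm] := eqVneq y m; first by rewrite lt_irr.
  apply/negP => lmy; have := lt_trans _ _ _ lmy (mmax _ yS ynm).
  by rewrite lt_irr.
have -> : [set y | lt y m]%SET = S :\ m.
  apply/setP => y; rewrite !inE; apply/idP/idP.
    move=> lym; rewrite (dS m) // andbT; apply: contraTneq lym => ->.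
    by rewrite lt_irr.
  by move=> /andP[ynm yS]; exact: mmax.
by rewrite addrA subrK.
Qed.

End telescoping.

(** * Marginals of a finite weight, and monotonicity of conditional entropy *)

Section marginals.
Variables (R : realType) (I E : finType) (p : {ffun I -> E} -> R).
Hypothesis p_ge0 : forall s, 0 <= p s.
Implicit Types (A B : {set I}) (s t : {ffun I -> E}).

Definition agreeb (A : {set I}) (s t : {ffun I -> E}) :=
  [forall i in A, s i == t i].

(** Taken at a full pattern [s] although only its values on [A] matter, so that marginals on
    different sets can be compared at the same pattern. *)
Definition marginal (A : {set I}) (s : {ffun I -> E}) :=
  \sum_(t | agreeb A s t) p t.

Lemma agreebP A s t : reflect (forall i, i \in A -> s i = t i) (agreeb A s t).
Proof.
apply: (iffP forallP) => [h i iA|h i].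
  by have /implyP/(_ iA)/eqP := h i.
by apply/implyP => iA; rewrite h.
Qed.

Lemma marginal_congr A s t : agreeb A s t -> marginal A s = marginal A t.
Proof.
move=> /agreebP st; apply: eq_bigl => r; apply/agreebP/agreebP => h i iA.
  by rewrite -st // h.
by rewrite st // h.
Qed.

Lemma marginal_ge0 A s : 0 <= marginal A s.
Proof. exact: sumr_ge0. Qed.

Lemma le_marginal_self A s : p s <= marginal A s.
Proof.
rewrite /marginal (bigD1 s) /=; last exact/agreebP.
by rewrite lerDl sumr_ge0.
Qed.

Lemma marginal_subset A B s : A \subset B -> marginal B s <= marginal A s.
Proof.
move=> /fintype.subsetP AB; rewrite /marginal [leLHS]big_mkcond [leRHS]big_mkcond.
apply: ler_sum => t _; case: ifPn => [/agreebP h|_]; last by case: ifP.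
by rewrite ifT //; apply/agreebP => i /AB /h.
Qed.

Lemma marginal_setT s : marginal finset.setT s = p s.
Proof.
rewrite /marginal (big_pred1 s) // => t; apply/agreebP/eqP => [h|-> //].
by apply/ffunP => i; rewrite h ?inE.
Qed.

Lemma marginal_set0 s : marginal finset.set0 s = \sum_t p t.
Proof. by apply: eq_bigl => t; apply/agreebP => i; rewrite inE. Qed.

(** The factor is the ratio p(x|A) / p(x|B) of conditional probabilities. Its mean is at most the
    total mass, because summing p(x|A) over the spin at [x] with the rest fixed gives at most 1.
    Only an inequality is claimed, since a quotient by a null marginal is 0. *)
Lemma sum_ratio_le (A B : {set I}) (x : I) : A \subset B ->
  \sum_s p s * (marginal (x |: A) s * marginal B s /
                (marginal A s * marginal (x |: B) s)) <= \sum_s p s.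
Proof.
move=> AB.
(* Expand [marginal B s] as a sum over [r] and exchange the sums. For fixed [r], all admissible [s]
   share their values on [x |: B] (at [x] those of [t], on [B] those of [r]), so their weights over
   that cylinder's mass sum to at most 1. *)
have inner t : \sum_(s | agreeb (x |: A) s t) p s * marginal B s / marginal (x |: B) s
    <= marginal A t.
  have -> : \sum_(s | agreeb (x |: A) s t) p s * marginal B s / marginal (x |: B) s
    = \sum_r p r * \sum_(s | agreeb (x |: A) s t && agreeb B s r) p s / marginal (x |: B) s.
    transitivity (\sum_(s | agreeb (x |: A) s t) \sum_(r | agreeb B s r)
        p r * (p s / marginal (x |: B) s)).
      by apply: eq_bigr => s _; rewrite -mulr_suml /marginal mulrAC mulrC.
    rewrite (exchange_big_dep predT) //=.
    by apply: eq_bigr => r _; rewrite mulr_sumr; apply: eq_bigl => s.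
  rewrite /marginal [leRHS]big_mkcond /=; apply: ler_sum => r _.
  case: (pickP (fun s => agreeb (x |: A) s t && agreeb B s r)) => [s0|none]; last first.
    by rewrite (big_pred0 _ _ _ _ none) mulr0; case: ifP.
  move=> /andP[/agreebP h1 /agreebP h2].
  have -> : agreeb A t r.
    apply/agreebP => i iA; rewrite -h1 ?inE ?iA ?orbT// h2//.
    by move/fintype.subsetP: AB; apply.
  rewrite -[leRHS]mulr1 ler_wpM2l //.
  have le : \sum_(s | agreeb (x |: A) s t && agreeb B s r) p s / marginal (x |: B) s
      <= \sum_(s | agreeb (x |: B) s0 s) p s / marginal (x |: B) s0.
    rewrite [leLHS]big_mkcond [leRHS]big_mkcond; apply: ler_sum => s _.
    case: ifPn => [/andP[/agreebP k1 /agreebP k2]|_]; last first.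
      by case: ifP => // _; rewrite divr_ge0 // marginal_ge0.
    have ss : agreeb (x |: B) s0 s.
      apply/agreebP => i; rewrite !inE => /orP[/eqP ->|iB].
        by rewrite h1 ?inE ?eqxx// k1 ?inE ?eqxx.
      by rewrite h2 // k2.
    by rewrite ss (marginal_congr _ _ _ ss).
  apply: (le_trans le); rewrite -mulr_suml -/(marginal _ _).
  have [->|n0] := eqVneq (marginal (x |: B) s0) 0; first by rewrite mul0r ler01.
  by rewrite divff.
(* Expanding [marginal (x |: A) s] over [t] and exchanging the sums brings out the left side of
   [inner], divided by [marginal A t]. *)
have -> : \sum_s p s * (marginal (x |: A) s * marginal B s /
                (marginal A s * marginal (x |: B) s))
  = \sum_t p t * ((\sum_(s | agreeb (x |: A) s t) p s * marginal B s / marginal (x |: B) s)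
      / marginal A t).
  transitivity (\sum_s \sum_(t | agreeb (x |: A) s t)
     p t * (p s * marginal B s / marginal (x |: B) s / marginal A t)).
    apply: eq_bigr => s _; rewrite {1}/marginal invfM.
    rewrite !mulr_suml mulr_sumr; apply: eq_bigr => t /agreebP st.
    have -> : marginal A t = marginal A s.
      by apply: marginal_congr; apply/agreebP => i iA; rewrite st // !inE iA orbT.
    by ring.
  rewrite (exchange_big_dep predT) //=.
  by apply: eq_bigr => t _; rewrite mulr_suml mulr_sumr; apply: eq_bigl.
apply: ler_sum => t _; rewrite -[leRHS]mulr1 ler_wpM2l //.
have [->|n0] := eqVneq (marginal A t) 0; first by rewrite invr0 mulr0 ler01.
by rewrite ler_pdivrMr ?mul1r // lt0r n0 marginal_ge0.
Qed.

(** Gibbs' inequality: the difference of the logarithms is ln X for the ratio X of conditional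
    probabilities, ln X is at most X - 1, and [sum_ratio_le] bounds the mean of X. Both sides are
    negatives of conditional entropies. *)
Lemma cond_entropy_antimono (A B : {set I}) (x : I) : A \subset B ->
  \sum_s p s * (ln (marginal (x |: A) s) - ln (marginal A s)) <=
  \sum_s p s * (ln (marginal (x |: B) s) - ln (marginal B s)).
Proof.
move=> AB; rewrite -subr_le0 -sumrB.
rewrite (le_trans (_ : _ <= \sum_s (p s * (marginal (x |: A) s * marginal B s /
                (marginal A s * marginal (x |: B) s)) - p s))) //; last first.
  by rewrite sumrB subr_le0 sum_ratio_le.
apply: ler_sum => s _.
have [ps0|psn0] := eqVneq (p s) 0; first by rewrite ps0 !mul0r subrr.
have ps_gt0 : 0 < p s by rewrite lt0r psn0 p_ge0.
have m_gt0 C : 0 < marginal C s by exact: lt_le_trans (le_marginal_self _ _).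
rewrite -mulrBr -[X in _ <= _ - X]mulr1 -mulrBr ler_wpM2l //.
set X := _ / _.
have X0 : 0 < X by rewrite divr_gt0 ?mulr_gt0.
have -> : ln (marginal (x |: A) s) - ln (marginal A s)
   - (ln (marginal (x |: B) s) - ln (marginal B s)) = ln X.
  rewrite /X ln_div ?posrE ?mulr_gt0 // !lnM ?posrE //; ring.
by have := @le_ln1Dx R (X - 1); rewrite subrKC; apply; rewrite ltrBrDl subrr.
Qed.

End marginals.

Arguments agreeb {I E}.
Arguments marginal {R I E}.

(** * Geometry of boxes, averages over boxes, and the lexicographic order *)

Definition Lam d n : set (site d) := [set x | forall i, `|x ord0 i| <= n%:Z].

Section boxes.
Variable d : nat.

Lemma site_of_inj n : injective (@site_of d n).
Proof.
move=> a b /rowP h; apply/ffunP => i; apply: val_inj => /=.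
by have := h i; rewrite !mxE => /addIr [].
Qed.

Lemma Lam_site_of n (b : boxn d n) : Lam d n (site_of b).
Proof. by move=> i; rewrite mxE; have := ltn_ord (b i); lia. Qed.

Lemma LamP n (x : site d) : Lam d n x -> exists b : boxn d n, site_of b = x.
Proof.
move=> xL.
have h i : (absz (x ord0 i + n%:Z)%R < 2 * n + 1)%N by have := xL i; lia.
exists [ffun i => Ordinal (h i)].
by apply/rowP => i; rewrite mxE ffunE /= -[x 0 i]/(x ord0 i); have := xL i; lia.
Qed.

Lemma Lam_le m n : (m <= n)%N -> Lam d m `<=` Lam d n.
Proof. by move=> mn x h i; have := h i; lia. Qed.

Lemma Lam_add m n (x y : site d) : Lam d m x -> Lam d n y -> Lam d (m + n) (x + y).
Proof.
move=> hx hy i; rewrite mxE; apply: le_trans (ler_normD _ _) _.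
by rewrite PoszD lerD.
Qed.

Lemma LamN n (x : site d) : Lam d n x -> Lam d n (- x).
Proof. by move=> hx i; rewrite mxE normrN; exact: hx. Qed.

Lemma finite_Lam n : finite_set (Lam d n).
Proof.
apply: (@sub_finite_set _ _ (range (@site_of d n))).
  by move=> x /LamP[b <-]; exists b.
by apply: finite_image; exact: finite_finset.
Qed.

Lemma finite_sub_Lam (D : set (site d)) : finite_set D -> exists n, D `<=` Lam d n.
Proof.
move=> /finite_seqP[s ->]; elim: s => [|x s [n IH]]; first by exists 0%N.
exists (maxn n (\max_(i < d) absz (x ord0 i))) => y /=.
rewrite inE => /orP[/eqP ->|ys].
  move=> i; have h : (absz (x ord0 i) <= \max_(i < d) absz (x ord0 i))%N.
    exact: (@leq_bigmax _ (fun i => absz (x ord0 i))).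
  by rewrite -abszE lez_nat (leq_trans h) // leq_maxr.
by apply: (Lam_le n) (IH y ys); rewrite leq_maxl.
Qed.

Definition bulk (N n : nat) (x : site d) := forall y, Lam d N y -> Lam d n (x + y).

(** The box of radius [n - N] injects into the bulk. *)
Lemma card_bulk (N n : nat) : (N <= n)%N ->
  ((2 * (n - N) + 1) ^ d <= #|[set b : boxn d n | `[< bulk N n (site_of b) >]]%SET|)%N.
Proof.
move=> Nn.
have wd (b : boxn d (n - N)) : exists c : boxn d n, site_of c = site_of b.
  by apply: LamP; apply: Lam_le (Lam_site_of _ b); rewrite leq_subr.
have [f fP] := choice wd.
have finj : injective f.
  by move=> a b ab; apply: site_of_inj; rewrite -!fP ab.
have -> : ((2 * (n - N) + 1) ^ d = #|[set: boxn d (n - N)]%SET|)%N.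
  by rewrite cardsT card_ffun !card_ord.
rewrite -(card_imset _ finj); apply: subset_leq_card.
apply/fintype.subsetP => c /imsetP[b _ ->]; rewrite inE; apply/asboolP => y yL.
by have := Lam_add _ _ _ _ (Lam_site_of _ b) yL; rewrite fP (subnK Nn).
Qed.

Lemma cardL_E (R : realType) n : cardL R d n = (2 * n%:R + 1) ^+ d.
Proof. by rewrite /cardL card_ffun !card_ord natrX natrD natrM. Qed.

Lemma cardL_gt0 (R : realType) n : 0 < cardL R d n.
Proof. by rewrite cardL_E exprn_gt0 // ltr_wpDl // mulr_ge0. Qed.

Lemma bernoulli_ineq (R : realType) (t : R) k : 0 <= t -> t <= 1 ->
  1 - k%:R * t <= (1 - t) ^+ k.
Proof.
move=> t0 t1; elim: k => [|k IH]; first by rewrite mul0r subr0 expr0.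
rewrite exprS -natr1; apply: (@le_trans _ _ ((1 - t) * (1 - k%:R * t))).
  have : 0 <= k%:R * (t * t) by rewrite !mulr_ge0.
  by nra.
by rewrite ler_wpM2l // subr_ge0.
Qed.

(** With t = 2N / (2n + 1), the bulk fills at least the fraction (1 - t)^d of the box. Bernoulli
    bounds the rest by d t, and 2n + 1 is at least n + 1, the inverse of [harmonic n]. *)
Lemma card_not_bulk (R : realType) (N n : nat) : (N <= n)%N ->
  #|[set b : boxn d n | ~~ `[< bulk N n (site_of b) >]]%SET|%:R
  <= cardL R d n * (d%:R * (2 * N%:R) * harmonic n).
Proof.
move=> Nn.
set A := [set b : boxn d n | `[< bulk N n (site_of b) >]]%SET.
have -> : [set b : boxn d n | ~~ `[< bulk N n (site_of b) >]]%SET = ~: A.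
  by apply/setP => b; rewrite !inE.
have cA : #|A|%:R + #|~: A|%:R = cardL R d n by rewrite -natrD cardsC.
have := card_bulk N n Nn; rewrite -(ler_nat R) natrX natrD natrM natrB // => lA.
pose t : R := 2 * N%:R / (2 * n%:R + 1).
have n1 : 0 < 2 * n%:R + 1 :> R by rewrite ltr_wpDl // mulr_ge0.
have t0 : 0 <= t by rewrite divr_ge0 // ?mulr_ge0 // ltW.
have Nn' : N%:R <= n%:R :> R by rewrite ler_nat.
have t1 : t <= 1 by rewrite ler_pdivrMr // mul1r; lra.
have e : 2 * (n%:R - N%:R) + 1 = (1 - t) * (2 * n%:R + 1) :> R.
  by rewrite mulrBl mul1r divfK ?gt_eqF //; ring.
have := bernoulli_ineq R t d t0 t1 => bt.
have L0 := ltW (cardL_gt0 R n).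
apply: (@le_trans _ _ (cardL R d n * (d%:R * t))).
  move: lA; rewrite e exprMn -cardL_E => lA.
  have := ler_wpM2r L0 bt; lra.
rewrite ler_wpM2l // /t -[leRHS]mulrA ler_wpM2l // ler_wpM2l ?mulr_ge0 //.
rewrite lef_pV2 ?posrE // -natr1 lerD2r.
by have : 0 <= n%:R :> R by []; lra.
Qed.

(** Used for both the entropy and the energy. First fix [N] with [eps N] small, which settles the
    bulk; then let [n] grow, so that the boundary sites, each off by at most [K], have vanishing
    density. *)
Lemma cvg_box_average (R : realType) (u : forall n, boxn d n -> R) (c K : R)
    (eps : nat -> R) :
  (forall n b, `|u n b - c| <= K) -> eps N @[N --> \oo] --> 0 ->
  (forall N n b, bulk N n (site_of b) -> `|u n b - c| <= eps N) ->
  (cardL R d n)^-1 * \sum_b u n b @[n --> \oo] --> c.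
Proof.
move=> uK epsc ueps; apply/cvgrPdistC_le => e e0.
have K0 : 0 <= K.
  by apply: le_trans (uK 0%N [ffun=> ord0]); exact: normr_ge0.
have e2 : 0 < e / 2 by rewrite divr_gt0.
have [N _ hN] : \forall N \near \oo, `|eps N - 0| <= e / 2.
  by move/cvgrPdistC_le : epsc => /(_ _ e2).
have {hN} := hN N (leqnn N); rewrite /= subr0 => hN.
pose C : R := d%:R * (2 * N%:R) * K.
have : C * harmonic n @[n --> \oo] --> C * 0 by apply: cvgMr; exact: cvg_harmonic.
rewrite mulr0 => /cvgrPdistC_le/(_ _ e2)[M _ hM].
exists (maxn M N) => // n; rewrite /= geq_max => /andP[Mn Nn].
have := hM n Mn; rewrite /= subr0 => hC.
have cL := cardL_gt0 R n.
have -> : (cardL R d n)^-1 * \sum_b u n b - c = (cardL R d n)^-1 * \sum_b (u n b - c).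
  rewrite sumrB sumr_const mulrBr; congr (_ - _).
  by rewrite -[_ *+ #|_|]mulr_natl -/(cardL R d n) mulKf // gt_eqF.
rewrite normrM ger0_norm ?invr_ge0 ?(ltW cL) // ler_pdivrMl //.
apply: le_trans (ler_norm_sum _ _ _) _.
pose P b := `[< bulk N n (@site_of d n b) >].
rewrite (bigID P) /=.
have s1 : \sum_(b | P b) `|u n b - c| <= cardL R d n * (e / 2).
  apply: (@le_trans _ _ (\sum_(b : boxn d n) e / 2)); last first.
    by rewrite sumr_const mulr_natl.
  rewrite [leLHS]big_mkcond; apply: ler_sum => b _; case: ifPn => [/asboolP h|_]; last exact: ltW.
  by apply: le_trans (ueps _ _ _ h) _; exact: le_trans (ler_norm _) hN.
have s2 : \sum_(b | ~~ P b) `|u n b - c| <= cardL R d n * (e / 2).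
  apply: (@le_trans _ _ (\sum_(b | ~~ P b) K)); first by apply: ler_sum.
  rewrite sumr_const -[leLHS]mulr_natl.
  have -> : #|[pred b | ~~ P b]| = #|[set b : boxn d n | ~~ `[< bulk N n (site_of b) >]]%SET|.
    by apply: eq_card => b; rewrite !inE.
  apply: le_trans (ler_wpM2r K0 (card_not_bulk R N n Nn)) _.
  rewrite -[leLHS]mulrA ler_wpM2l ?(ltW cL) // [leLHS]mulrAC.
  exact: le_trans (ler_norm _) hC.
by move: s1 s2; lra.
Qed.

Lemma lexlt_irr (x : site d) : ~ lexlt x x.
Proof. by case=> i [_]; rewrite ltxx. Qed.

Lemma lexlt_trans (y x z : site d) : lexlt x y -> lexlt y z -> lexlt x z.
Proof.
move=> [i [hi li]] [j [hj lj]]; have [ij|ji|/val_inj ij] := ltngtP i j.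
- exists i; split=> [k ki|]; first by rewrite hi // hj // (ltn_trans ki).
  by rewrite -hj.
- exists j; split=> [k kj|]; first by rewrite hi ?hj // (ltn_trans kj).
  by rewrite hi.
- subst j; exists i; split=> [k ki|]; first by rewrite hi ?hj.
  exact: lt_trans lj.
Qed.

Lemma lexlt_total (x y : site d) : x <> y -> lexlt x y \/ lexlt y x.
Proof.
move=> xy; have [i0 ni0] : exists i, x ord0 i != y ord0 i.
  apply: contrapT => /forallNP h; apply: xy; apply/rowP => i.
  by have /negP := h i; rewrite negbK => /eqP.
have [i ni imin] := @arg_minnP _ i0 (fun i => x ord0 i != y ord0 i) val ni0.
have eqs (j : 'I_d) : (j < i)%N -> x ord0 j = y ord0 j.
  move=> ji; apply/eqP; apply: contraTT ji => /imin; by rewrite -leqNgt.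
move: ni; rewrite neq_lt => /orP[h|h]; [left|right]; exists i; split => // j ji.
by rewrite eqs.
Qed.

Lemma lexlt_add (z x y : site d) : lexlt (z + x) (z + y) <-> lexlt x y.
Proof.
split=> -[i [h l]]; exists i; split=> [j ji|].
- by have := h j ji; rewrite !mxE => /addrI.
- by move: l; rewrite !mxE ltrD2l.
- by rewrite !mxE h.
- by rewrite !mxE ltrD2l.
Qed.

Lemma lexlt_add0 (x y : site d) : lexlt x (x + y) <-> lexlt 0 y.
Proof. by rewrite -{1}[x]addr0 lexlt_add. Qed.

End boxes.

(** * Configurations, patterns in boxes, and measurability *)

Section configurations.
Variables (d : nat) (E : finType) (pl : E).
Local Notation OM := (Omega d pl).
Local Notation pat := (@patcyl d E pl _).

Definition pattern_of n (w : OM) : {ffun boxn d n -> E} := [ffun b => w (site_of b)].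

Definition config_of n (s : {ffun boxn d n -> E}) : OM :=
  fun x => if [pick b : boxn d n | site_of b == x] is Some b then s b else pl.

Lemma config_of_site n (s : {ffun boxn d n -> E}) b : config_of n s (site_of b) = s b.
Proof.
rewrite /config_of; case: pickP => [c /eqP/site_of_inj -> //|/(_ b)].
by rewrite eqxx.
Qed.

Lemma config_ofK n : cancel (@config_of n) (@pattern_of n).
Proof. by move=> s; apply/ffunP => b; rewrite ffunE config_of_site. Qed.

Lemma cyl_on_config_of n (w : OM) : cyl_on (Lam d n) w (config_of n (pattern_of n w)).
Proof. by move=> x /LamP[b <-]; rewrite config_of_site ffunE. Qed.

Lemma cyl_on_sym (L : set (site d)) (w w' : OM) : cyl_on L w w' -> cyl_on L w' w.
Proof. by move=> h x Lx; rewrite h. Qed.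

Lemma cyl_on_trans (L : set (site d)) (w1 w2 w3 : OM) :
  cyl_on L w1 w2 -> cyl_on L w2 w3 -> cyl_on L w1 w3.
Proof. by move=> h k x Lx; rewrite k // h. Qed.

Lemma cyl_on_sub (L L' : set (site d)) (w : OM) :
  L `<=` L' -> cyl_on L' w `<=` cyl_on L w.
Proof. by move=> LL w' h x /LL /h. Qed.

Lemma pattern_of_eq n (w w' : OM) : pattern_of n w = pattern_of n w' <-> cyl_on (Lam d n) w w'.
Proof.
split=> [/ffunP h x /LamP[b <-]|h]; first by have := h b; rewrite !ffunE.
by apply/ffunP => b; rewrite !ffunE h //; exact: Lam_site_of.
Qed.

Lemma patcyl_eq n s (w : OM) : patcyl s w <-> pattern_of n w = s.
Proof.
split=> [h|<- b]; last by rewrite ffunE.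
by apply/ffunP => b; rewrite ffunE h.
Qed.

Lemma patcyl_pattern_of n (w : OM) : patcyl (pattern_of n w) = cyl_on (Lam d n) w.
Proof.
apply/seteqP; split=> w'; first by move/patcyl_eq/esym/pattern_of_eq.
by move=> /pattern_of_eq h; apply/patcyl_eq.
Qed.

Lemma measurable_coord (x : site d) (a : E) : measurable [set w : OM | w x = a].
Proof. by apply: sub_sigma_algebra; exists x, a. Qed.

(** Pointwise counterpart of membership in [sF L]; the two are equivalent when [L] is a box. *)
Definition determined (L : set (site d)) (A : set OM) :=
  forall w w', cyl_on L w w' -> A w -> A w'.

Lemma sF_cyl_on (L L' : set (site d)) (w : OM) :
  finite_set L -> L `<=` L' -> sF L' (cyl_on L w).
Proof.
move=> fL LL'; have [s sL] := (finite_seqP L).1 fL.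
have {fL} : forall x, x \in s -> L' x by move=> x xs; apply: LL'; rewrite sL.
rewrite {}sL {LL' L} => sL'.
have sA : sigma_algebra setT (sF (pl := pl) L') by exact: smallest_sigma_algebra.
elim: s sL' => [|x s IH] h.
  have -> : cyl_on [set` [::]] w = setT `\` set0.
    by apply/seteqP; split=> // w' _; split.
  by case: sA => s0 sC _; exact: sC.
have {IH} sI := IH (fun y ys => h y (@mem_behead _ (x :: s) y ys)).
have -> : cyl_on [set` x :: s] w = [set w' | w' x = w x] `&` cyl_on [set` s] w.
  apply/seteqP; split=> w'.
    move=> k; split; first by apply: k; rewrite /= inE eqxx.
    by move=> y ys; apply: k; rewrite /= inE; apply/orP; right.
  by move=> [k1 k2] y /=; rewrite inE => /orP[/eqP -> //|]; exact: k2.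
pose T' := g_sigma_algebraType (cylgen (pl := pl) L').
apply: (@measurableI _ T') => //.
apply: sub_sigma_algebra; exists x, (w x); split => //.
by apply: h; rewrite inE eqxx.
Qed.

(** Since [E] is finite, such an event is a finite union of cylinders on the box. *)
Lemma sF_determined_Lam n (A : set OM) : determined (Lam d n) A -> sF (Lam d n) A.
Proof.
move=> hA; pose T' := g_sigma_algebraType (@cylgen d E pl (Lam d n)).
have -> : A = \bigcup_(s in [set s : {ffun boxn d n -> E} | A (config_of n s)])
    cyl_on (Lam d n) (config_of n s).
  apply/seteqP; split=> [w Aw|w [s /= As h]]; last exact: hA h As.
  exists (pattern_of n w) => /=; first exact: hA (cyl_on_config_of n w) Aw.
  by apply: cyl_on_sym; exact: cyl_on_config_of.
apply: (@fin_bigcup_measurable _ T'); first exact: finite_finset.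
by move=> s _; apply: sF_cyl_on => //; exact: finite_Lam.
Qed.

Lemma sF_measurable (L : set (site d)) (A : set OM) : sF L A -> measurable A.
Proof.
apply: sub_smallest2r; first exact: smallest_sigma_algebra.
by move=> _ [x [a [_ ->]]]; exists x, a.
Qed.

Lemma measurable_determined n (A : set OM) : determined (Lam d n) A -> measurable A.
Proof. by move=> hA; apply: sF_measurable (sF_determined_Lam n A hA). Qed.

Lemma measurable_patcyl n (s : {ffun boxn d n -> E}) : measurable (pat s).
Proof.
apply: (@measurable_determined n) => w w' /pattern_of_eq h /patcyl_eq k.
by apply/patcyl_eq; rewrite -h.
Qed.

Lemma measurable_cyl_on (L : set (site d)) (w : OM) :
  finite_set L -> measurable (cyl_on L w).
Proof.
move=> /finite_sub_Lam[n Ln]; apply: (@measurable_determined n) => w1 w2 h k x Lx.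
by rewrite h ?k //; exact: Ln.
Qed.

Lemma sF_determined (L : set (site d)) (A : set OM) : sF L A -> determined L A.
Proof.
(* The two-sided form is stable under complement, so these events form a sigma-algebra containing
   the generators. *)
suff H : sF L `<=` [set A : set OM | forall w w' : OM, cyl_on L w w' -> (A w <-> A w')].
  by move=> sA w w' ww' Aw; apply/(H A sA w w' ww').
apply: smallest_sub; first split.
- by [].
- move=> B hB w w' ww'; have := hB w w' ww'; rewrite /setD /=.
  by move=> h; split=> -[? k]; split=> // /h.
- move=> F hF w w' ww'; split=> -[i _ Fi]; exists i => //; exact/(hF i w w' ww').
- move=> B [x [a [Lx ->]]] w w' ww' /=.
  by rewrite ww'.
Qed.

Variable R : realType.

Lemma measurable_fun_pattern_of n (F : {ffun boxn d n -> E} -> R) :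
  measurable_fun [set: OM] (fun w => F (pattern_of n w)).
Proof.
move=> _ B mB; rewrite setTI; apply: (@measurable_determined n) => w w' /pattern_of_eq ww' /=.
by rewrite ww'.
Qed.

Lemma bounded_integrable (P : probability OM R) (f : OM -> R) (M : R) :
  measurable_fun setT f -> (forall w, `|f w| <= M) -> P.-integrable setT (EFin \o f).
Proof.
move=> mf fM; apply: measurable_bounded_integrable => //.
  by rewrite (@le_lt_trans _ _ 1%E) ?probability_le1 // ltry.
exists M; split; first by rewrite num_real.
by move=> x Mx w _ /=; rewrite (le_trans (fM w)) // ltW.
Qed.

Lemma integrable_pattern_of (P : probability OM R) n (F : {ffun boxn d n -> E} -> R) :
  P.-integrable setT (EFin \o (fun w => F (pattern_of n w))).
Proof.
apply: (bounded_integrable _ _ (\sum_s `|F s|)); first exact: measurable_fun_pattern_of.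
by move=> w; rewrite (bigD1 (pattern_of n w)) //= lerDl sumr_ge0.
Qed.

Lemma integral_pattern_of (P : probability OM R) n (F : {ffun boxn d n -> E} -> R) :
  (\int[P]_w (F (pattern_of n w))%:E)%E = (\sum_s fine (P (pat s)) * F s)%:E.
Proof.
have Fe w : (F (pattern_of n w))%:E =
    (\sum_s (F s * \1_(pat s) w)%:E)%E.
  rewrite (bigD1 (pattern_of n w)) //= big1 ?adde0; last first.
    move=> s ns; rewrite indicE memNset ?mulr0 // => /patcyl_eq h.
    by rewrite h eqxx in ns.
  by rewrite indicE mem_set ?mulr1 //; exact/patcyl_eq.
under eq_integral do rewrite Fe.
have mpat s := measurable_patcyl n s.
have ipat s : P.-integrable setT (fun w => (F s * \1_(pat s) w)%:E).
  apply: (bounded_integrable _ _ `|F s|).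
    apply: measurable_funM; first exact: measurable_cst.
    exact: measurable_indic.
  move=> w; rewrite normrM ler_piMr // indicE.
  by case: (_ \in _); rewrite ?normr0 ?normr1 ?ler01.
rewrite integral_sum //= -sumEFin; apply: eq_bigr => s _.
under eq_integral do rewrite EFinM.
rewrite integralZl //=; last first.
  apply: (bounded_integrable _ _ 1); first exact: measurable_indic.
  by move=> w; rewrite indicE; case: (_ \in _); rewrite ?normr0 ?normr1 ?ler01.
rewrite integral_indic // setIT muleC EFinM fineK //.
exact: fin_num_measure.
Qed.

Lemma Rintegral_pattern_of (P : probability OM R) n (F : {ffun boxn d n -> E} -> R) :
  Rintegral P setT (fun w => F (pattern_of n w)) = \sum_s fine (P (pat s)) * F s.
Proof. by rewrite /Rintegral integral_pattern_of. Qed.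

Lemma prob_determined (P : probability OM R) n (A : set OM) : determined (Lam d n) A ->
  fine (P A) = \sum_(s | `[< A (config_of n s) >]) fine (P (pat s)).
Proof.
move=> dA; have mA := measurable_determined n A dA.
pose F s : R := (`[< A (config_of n s) >])%:R.
have -> : P A = (\int[P]_w (F (pattern_of n w))%:E)%E.
  rewrite -{1}(setIT A) -integral_indic //; apply: eq_integral => w _.
  rewrite indicE /=; congr ((nat_of_bool _)%:R%:E).
  apply/idP/idP => [/set_mem Aw|/asboolP Aw].
    by apply/asboolP; exact: dA (cyl_on_config_of n w) Aw.
  by apply/mem_set; apply: dA Aw; apply: cyl_on_sym; exact: cyl_on_config_of.
rewrite integral_pattern_of /= [RHS]big_mkcond; apply: eq_bigr => s _.
by rewrite /F; case: ifP; rewrite ?mulr1 ?mulr0.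
Qed.

(** The level set of [f] through [w] lies in [sF D], hence contains every configuration that agrees
    with [w] on a box containing [D]. *)
Lemma local_fun_pattern_of (f : OM -> R) : local_fun f ->
  exists n F, f = (fun w => F (pattern_of n w)).
Proof.
move=> [D [/finite_sub_Lam[n Dn] fD]]; exists n, (fun s => f (config_of n s)).
apply/funext => w.
have /sF_determined h := fD [set f w] (measurable_set1 _).
apply/esym; apply: (h w) => //.
by apply: cyl_on_sub Dn _ _; exact: cyl_on_config_of.
Qed.

Lemma measurable_fun_Omega (d' : measure_display) (T : measurableType d') (f : T -> OM) :
  (forall x a, measurable [set t | f t x = a]) -> measurable_fun setT f.
Proof.
move=> mf; apply: (@measurability _ _ T OM setT f (@cylgen d E pl setT)) => //.
by move=> _ [_ [x [a [_ ->]]] <-]; rewrite setTI; exact: mf.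
Qed.

Lemma measurable_tau (x : site d) : measurable_fun setT (@tau d E pl x).
Proof. by apply: measurable_fun_Omega => y a; exact: measurable_coord. Qed.

Lemma measurable_plusify : measurable_fun setT (@plusify d E pl).
Proof.
apply: measurable_fun_Omega => y a; rewrite /plusify.
case: `[< lexlt 0 y >]; last exact: measurable_coord.
have [->|ap] := eqVneq pl a.
  by rewrite (_ : [set _ | _] = setT) //; apply/seteqP; split.
rewrite (_ : [set _ | _] = set0) //; apply/seteqP; split => // w /= h.
by rewrite h eqxx in ap.
Qed.

Lemma Rintegral_tau (P : probability OM R) (x : site d) (f : OM -> R) (M : R) :
  translation_invariant P -> measurable_fun setT f -> (forall w, `|f w| <= M) ->
  Rintegral P setT (fun w => f (tau x w)) = Rintegral P setT f.
Proof.
move=> invP mf fM; rewrite /Rintegral; congr fine.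
have mt := measurable_tau x.
rewrite [RHS](@eq_measure_integral _ _ _ _ (pushforward P (tau x))) /=; last first.
  by move=> A mA _; rewrite -(invP x).
rewrite integral_pushforward //=.
- exact/measurable_EFinP.
- rewrite preimage_setT; apply: (bounded_integrable _ (fun w => f (tau x w)) M) => //.
  exact: measurableT_comp.
Qed.

End configurations.

Arguments pattern_of {d E pl}.
Arguments config_of {d E pl}.

(** * The lexicographic order carried over to box indices *)

Definition blt d n : rel (boxn d n) :=
  fun b c => `[< lexlt (site_of b) (site_of c) >].

Section box_order.
Variables d n : nat.

Lemma blt_irr : irreflexive (@blt d n).
Proof. by move=> b; apply/asboolP/lexlt_irr. Qed.

Lemma blt_trans : transitive (@blt d n).
Proof. by move=> b a c /asboolP h /asboolP k; apply/asboolP; exact: lexlt_trans k. Qed.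

Lemma blt_total (b c : boxn d n) : b != c -> blt d n b c || blt d n c b.
Proof.
move=> /eqP bc; have : site_of b <> site_of c by move/site_of_inj.
by move=> /lexlt_total[h|h]; apply/orP; [left|right]; exact/asboolP.
Qed.

Lemma setC_blt (b : boxn d n) :
  [set c | ~~ blt d n b c]%SET = b |: [set c | blt d n c b]%SET.
Proof.
apply/setP => c; rewrite !inE; have [->|cb] := eqVneq c b; first by rewrite blt_irr.
have := blt_total c b cb; case: (boolP (blt d n c b)) => //= h; last by move=> ->.
by move=> _; apply/negP => k; have := blt_trans _ _ _ h k; rewrite blt_irr.
Qed.

End box_order.

(** * Conditional entropies and existence of the Kolmogorov-Sinai entropy *)

Section entropy.
Variables (d : nat) (E : finType) (pl : E) (R : realType).
Local Notation OM := (Omega d pl).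
Local Notation pat := (@patcyl d E pl _).
Variable P : probability OM R.

Definition pweight n (s : {ffun boxn d n -> E}) : R := fine (P (pat s)).

Definition boxset n (L : set (site d)) : {set boxn d n} :=
  [set b | `[< L (site_of b) >]]%SET.

Definition cyl_prob (L : set (site d)) (w : OM) : R := fine (P (cyl_on L w)).

(** Conditional entropy of the spin at [x] given the spins in [L], as the mean of minus the log
    conditional probability. *)
Definition cond_ent (L : set (site d)) (x : site d) : R :=
  Rintegral P setT (fun w => ln (cyl_prob L w) - ln (cyl_prob (x |` L) w)).

Lemma pweight_ge0 n (s : {ffun boxn d n -> E}) : 0 <= pweight n s.
Proof. by rewrite fine_ge0. Qed.

Lemma sum_pweight n : \sum_s pweight n s = 1.
Proof.
have h := Rintegral_pattern_of _ _ _ _ P n (fun=> 1).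
rewrite Rintegral_cst // mul1r in h.
transitivity (fine (P setT)); last by rewrite probability_setT.
by apply: etrans (esym h); apply: eq_bigr => s _; rewrite mulr1.
Qed.

Lemma cyl_prob_marginal n (L : set (site d)) w : L `<=` Lam d n ->
  cyl_prob L w = marginal (pweight n) (boxset n L) (pattern_of n w).
Proof.
move=> Ln; rewrite /cyl_prob (prob_determined _ _ _ _ _ n); last first.
  move=> w1 w2 h k x Lx; rewrite h ?k //; exact: Ln.
apply: eq_bigl => s; apply/asboolP/agreebP => [h b|h x Lx].
  by rewrite inE ffunE => /asboolP Lb; rewrite -h // config_of_site.
have [b bx] := LamP _ _ _ (Ln _ Lx); rewrite -bx config_of_site.
by have := h b; rewrite inE ffunE => -> //; rewrite bx; exact/asboolP.
Qed.

Lemma boxsetU1 n (L : set (site d)) (b : boxn d n) :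
  boxset n (site_of b |` L) = b |: boxset n L.
Proof.
apply/setP => c; rewrite !inE; apply/asboolP/orP => [[/site_of_inj ->|h]|[/eqP ->|/asboolP h]].
- by left.
- by right; apply/asboolP.
- by left.
- by right.
Qed.

(** Reduction to a finite weight. Any box containing [L] and the site may be used, so two
    conditioning sets can be compared inside a common box. *)
Lemma cond_entE n (L : set (site d)) (b : boxn d n) : L `<=` Lam d n ->
  cond_ent L (site_of b) = - \sum_s pweight n s *
    (ln (marginal (pweight n) (b |: boxset n L) s)
     - ln (marginal (pweight n) (boxset n L) s)).
Proof.
move=> Ln; rewrite -sumrN.
have bLn : (site_of b |` L) `<=` Lam d n.
  by move=> x [->|/Ln //]; exact: Lam_site_of.
pose F s := ln (marginal (pweight n) (boxset n L) s) -
  ln (marginal (pweight n) (b |: boxset n L) s).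
transitivity (Rintegral P setT (fun w => F (pattern_of n w))).
  apply: eq_Rintegral => w _; rewrite (cyl_prob_marginal n) // (cyl_prob_marginal n) //.
  by rewrite boxsetU1.
by rewrite Rintegral_pattern_of; apply: eq_bigr => s _; rewrite -mulrN opprB.
Qed.

Lemma cond_ent_antimono n (L L' : set (site d)) x :
  L `<=` L' -> L' `<=` Lam d n -> Lam d n x -> cond_ent L' x <= cond_ent L x.
Proof.
move=> LL' L'n /LamP[b <-]; rewrite !(@cond_entE n) //; last exact: subset_trans L'n.
rewrite lerN2; apply: cond_entropy_antimono; first exact: pweight_ge0.
apply/fintype.subsetP => c; rewrite !finset.in_set => /asboolP h; apply/asboolP; exact: LL'.
Qed.

Lemma cond_ent_ge0 n (L : set (site d)) x :
  L `<=` Lam d n -> Lam d n x -> 0 <= cond_ent L x.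
Proof.
move=> Ln /LamP[b <-]; rewrite (@cond_entE n) // -sumrN sumr_ge0 // => s _.
have [->|psn0] := eqVneq (pweight n s) 0; first by rewrite mul0r oppr0.
have p_gt0 : 0 < pweight n s by rewrite lt0r psn0 pweight_ge0.
have m_gt0 C : 0 < marginal (pweight n) C s.
  by apply: lt_le_trans (le_marginal_self _ _ _ _ _ _ _) => //; exact: pweight_ge0.
rewrite -mulrN mulr_ge0 ?pweight_ge0 // opprB subr_ge0 ler_ln ?posrE //.
by apply: marginal_subset; [exact: pweight_ge0|exact: finset.subsetUr].
Qed.

Hypothesis invP : translation_invariant P.

Lemma cyl_prob_tau (L : set (site d)) x (w : OM) : finite_set L ->
  cyl_prob [set x + y | y in L] w = cyl_prob L (tau x w).
Proof.
move=> fL; rewrite /cyl_prob -(invP x (cyl_on L _)); last exact: measurable_cyl_on.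
congr (fine (P _)); apply/seteqP; split => w' h y; first by move=> Ly; apply: h; exists y.
by move=> [z Lz <-]; exact: h.
Qed.

Lemma cond_ent_tau (L : set (site d)) x : finite_set L ->
  cond_ent [set x + y | y in L] x = cond_ent L 0.
Proof.
move=> fL; rewrite /cond_ent.
have [n Ln] := finite_sub_Lam _ _ fL.
have L0n : (0 |` L) `<=` Lam d n by move=> y [->|/Ln //] i; rewrite mxE normr0.
have eqL : x |` [set x + y | y in L] = [set x + y | y in 0 |` L].
  apply/seteqP; split=> z.
    by move=> [->|[y Ly <-]]; [exists 0; rewrite ?addr0 //; left|exists y => //; right].
  by move=> [y [->|Ly] <-]; [left; rewrite addr0|right; exists y].
rewrite eqL.
have fL0 : finite_set (0 |` L) by rewrite finite_setU; split.
under eq_Rintegral do rewrite !cyl_prob_tau //.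
pose F s := ln (marginal (pweight n) (boxset n L) s) -
  ln (marginal (pweight n) (boxset n (0 |` L)) s).
have FE w : ln (cyl_prob L w) - ln (cyl_prob (0 |` L) w) = F (pattern_of n w).
  by rewrite !(cyl_prob_marginal n).
under eq_Rintegral do rewrite FE.
under [RHS]eq_Rintegral do rewrite FE.
apply: (Rintegral_tau _ _ _ _ _ _ (fun w => F (pattern_of n w)) (\sum_s `|F s|)) => //.
  exact: measurable_fun_pattern_of.
by move=> w; rewrite (bigD1 (pattern_of n w)) //= lerDl sumr_ge0.
Qed.

(** Chain rule: for each pattern, the log marginals telescope over the lexicographic down-sets of
    the box, from total mass 1 to the full pattern. *)
Lemma ks_n_cond_ent n : ks_n P n = (cardL R d n)^-1 *
  \sum_(b : boxn d n) cond_ent [set y | Lam d n y /\ lexlt y (site_of b)] (site_of b).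
Proof.
rewrite /ks_n -mulrN; congr (_ * _).
have sub (b : boxn d n) : [set y | Lam d n y /\ lexlt y (site_of b)] `<=` Lam d n.
  by move=> y [].
under [RHS]eq_bigr => b _ do rewrite (@cond_entE n) //.
rewrite sumrN; congr (- _); rewrite exchange_big /=; apply: eq_bigr => s _.
rewrite -mulr_sumr -/(pweight n s); congr (_ * _).
have := telescope_order _ (@blt d n) (@blt_irr d n) (@blt_trans d n) (@blt_total d n)
  _ (fun S => ln (marginal (pweight n) S s)).
rewrite marginal_setT marginal_set0 sum_pweight ln1 subr0 => <-.
apply: eq_bigr => b _; rewrite setC_blt.
have -> // : boxset n [set y | Lam d n y /\ lexlt y (site_of b)] = [set c | blt d n c b]%SET.
apply/setP => c; rewrite !finset.in_set; apply/asboolP/asboolP => [[]//|h].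
by split=> //; exact: Lam_site_of.
Qed.

(* Conditional entropies decrease with the conditioning set, so the entropy of
   a spin given its past in the box is squeezed between two past-box values. *)
Lemma cvg_ks_n : exists h : R, ks_n P n @[n --> \oo] --> h.
Proof.
pose past N : set (site d) := [set y | Lam d N y /\ lexlt y 0].
have L0 n : Lam d n 0 by move=> i; rewrite mxE normr0.
pose cN N := cond_ent (past N) 0.
have cN_ge0 N : 0 <= cN N by apply: (@cond_ent_ge0 N) => // x [].
have cN_dec : {homo cN : n m / (n <= m)%N >-> m <= n}.
  move=> n m nm; apply: (@cond_ent_antimono m) => //; last by move=> x [].
  by move=> x [xn xl]; split => //; exact: Lam_le xn.
have lb : has_lbound (range cN) by exists 0 => _ [n _ <-].
pose c := inf (range cN).
have cvgc : cN n @[n --> \oo] --> c by exact: nonincreasing_cvgn.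
have c_le n : c <= cN n by apply: ge_inf => //; exists n.
(* The unconditioned entropy of one spin dominates every term of the average. *)
pose K := cond_ent set0 0.
exists c.
have -> : ks_n P = (fun n => (cardL R d n)^-1 * \sum_(b : boxn d n)
    cond_ent [set y | Lam d n y /\ lexlt y (site_of b)] (site_of b)).
  by apply/funext => n; exact: ks_n_cond_ent.
(* The past of [x] in the box, recentred at the origin. It lies in [past (n + n)], which gives the
   lower bound [c]; for [x] in the bulk it contains [past N], which gives the upper bound [cN N]. *)
pose past' n (x : site d) := [set z | Lam d n (x + z) /\ lexlt z 0].
have uE n (b : boxn d n) : cond_ent [set y | Lam d n y /\ lexlt y (site_of b)] (site_of b)
    = cond_ent (past' n (site_of b)) 0.
  have sub : past' n (site_of b) `<=` Lam d (n + n).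
    move=> z [h _]; rewrite -[z](addKr (site_of b)); apply: Lam_add => //.
    by apply: LamN; exact: Lam_site_of.
  rewrite -(cond_ent_tau _ (site_of b)); last exact: sub_finite_set sub (finite_Lam _ _).
  congr cond_ent; apply/seteqP; split=> y.
    move=> [yn yl]; exists (- site_of b + y); last by rewrite addNKr.
    split; first by rewrite addNKr.
    by apply/(lexlt_add _ (site_of b)); rewrite addNKr addr0.
  move=> [z [zn zl] <-]; split=> //.
  by rewrite -[X in lexlt _ X]addr0; apply/lexlt_add.
have sub2 n (b : boxn d n) : past' n (site_of b) `<=` past (n + n)%N.
  move=> z [h zl]; split => //; rewrite -[z](addKr (site_of b)); apply: Lam_add => //.
  by apply: LamN; exact: Lam_site_of.
have lbu n (b : boxn d n) : c <= cond_ent (past' n (site_of b)) 0.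
  apply: le_trans (c_le (n + n)%N) _; apply: (@cond_ent_antimono (n + n)%N) => //.
  by move=> x [].
apply: (cvg_box_average _ _ _ _ (K - c) (fun N => cN N - c)).
- move=> n b; rewrite uE ger0_norm ?subr_ge0 // lerB //.
  by apply: (@cond_ent_antimono (n + n)%N) => // x /sub2[].
- by rewrite -(subrr c); apply: cvgB => //; exact: cvg_cst.
- move=> N n b hb; rewrite uE ger0_norm ?subr_ge0 // lerB //.
  apply: (@cond_ent_antimono (n + n)%N) => //; last by move=> x /sub2[].
  by move=> x [xN xl]; split => //; exact: hb.
Qed.

End entropy.

(** * Continuity points, and oscillation of the single-site kernel *)

Section continuity.
Variables (d : nat) (E : finType) (pl : E) (R : realType).
Local Notation OM := (Omega d pl).
Local Notation pat := (@patcyl d E pl _).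

(* Continuity of [g] at [w] in a form that involves [w] only through finitely
   many of its coordinates at a time; this makes the set of such [w] measurable. *)
Definition cont_set (g : OM -> R) : set OM :=
  [set w | forall k, exists N, forall w1 w2, cyl_on (Lam d N) w w1 ->
     cyl_on (Lam d N) w w2 -> `|g w1 - g w2| <= k.+1%:R^-1].

Lemma measurable_cont_set g : measurable (cont_set g).
Proof.
have -> : cont_set g = \bigcap_k \bigcup_N [set w | forall w1 w2, cyl_on (Lam d N) w w1 ->
     cyl_on (Lam d N) w w2 -> `|g w1 - g w2| <= k.+1%:R^-1].
  apply/seteqP; split=> w h k; first by move=> _; have [N hN] := h k; exists N.
  by have [N _ hN] := h k I; exists N.
apply: bigcap_measurableType => k _; apply: bigcup_measurable => N _.
apply: (measurable_determined _ _ _ N) => w w' ww' h w1 w2 h1 h2.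
by apply: h; [exact: cyl_on_trans ww' h1|exact: cyl_on_trans ww' h2].
Qed.

Lemma small_inv (e : R) : 0 < e -> exists k, k.+1%:R^-1 < e.
Proof. by move=> /ltr_add_invr[k]; rewrite add0r; exists k. Qed.

Lemma ex_uniform_bound (I : finType) (Q : I -> nat -> Prop) :
  (forall i m n, (m <= n)%N -> Q i m -> Q i n) ->
  (forall i, exists n, Q i n) -> exists n, forall i, Q i n.
Proof.
move=> mono /choice[f fP]; exists (\max_i f i) => i.
by apply: mono (fP i); exact: leq_bigmax.
Qed.

Variable gamma : kernel_fam d pl R.

(** Local functions are finite combinations of indicators of box patterns, and finite volumes are
    listed by sequences, so continuity at [w] becomes a countable family of conditions. *)
Lemma cont_pointP (w : OM) : cont_point gamma w <->
  forall (l : seq (site d)) n (s : {ffun boxn d n -> E}),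
    cont_set (fun w' => fine (gamma [set` l] w' (pat s))) w.
Proof.
split=> [cw l n s k|cw L fL f lf e e0].
  pose F (t : {ffun boxn d n -> E}) : R := (t == s)%:R.
  have lF : local_fun (fun w' : OM => F (pattern_of n w')).
    exists (Lam d n); split; first exact: finite_Lam.
    move=> B _; apply: sF_determined_Lam => w1 w2 /pattern_of_eq h /=.
    by rewrite h.
  (* Halved because [cont_point] compares with the value at [w], whereas [cont_set] compares two
     nearby values with each other. *)
  have e0 : 0 < k.+1%:R^-1 / 2 :> R by rewrite divr_gt0.
  have fl : finite_set [set` l] by exact: finite_seq.
  have [D [/finite_sub_Lam[N DN] h]] := cw [set` l] fl _ lF _ e0.
  have intE w' : fine (\int[gamma [set` l] w']_z (F (pattern_of n z))%:E)%E
      = fine (gamma [set` l] w' (pat s)).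
    rewrite integral_pattern_of /= (bigD1 s) //= big1 ?addr0 /F ?eqxx ?mulr1 //.
    by move=> t /negbTE ->; rewrite mulr0.
  exists N => w1 w2 h1 h2.
  have k1 := h w1 (fun y Dy => h1 y (DN y Dy)).
  have k2 := h w2 (fun y Dy => h2 y (DN y Dy)).
  rewrite !intE in k1 k2.
  set c := fine (gamma [set` l] w _) in k1 k2.
  set x := fine (gamma [set` l] w1 _) in k1 *.
  set y := fine (gamma [set` l] w2 _) in k2 *.
  have -> : x - y = (x - c) - (y - c) by ring.
  rewrite (le_trans (ler_normB _ _)) // [leRHS]splitr.
  by rewrite lerD // ltW.
have [n [F fE]] := local_fun_pattern_of _ _ _ _ _ lf.
have [l lL] := (finite_seqP L).1 fL; rewrite {}lL {L fL}.
(* The added 1 keeps [M] positive even if [F] vanishes. *)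
pose M : R := \sum_s `|F s| + 1.
have M0 : 0 < M by rewrite ltr_wpDl // sumr_ge0.
have [k hk] := small_inv _ (divr_gt0 e0 M0).
have [N hN] : exists N, forall s : {ffun boxn d n -> E}, forall w1 w2, cyl_on (Lam d N) w w1 ->
     cyl_on (Lam d N) w w2 -> `|fine (gamma [set` l] w1 (pat s)) -
        fine (gamma [set` l] w2 (pat s))| <= k.+1%:R^-1.
  apply: ex_uniform_bound => [s i j ij h w1 w2 h1 h2|s]; last exact: cw.
  by apply: h; apply: cyl_on_sub h1 || apply: cyl_on_sub h2; exact: Lam_le.
exists (Lam d N); split; first exact: finite_Lam.
move=> w' ww'; rewrite fE !integral_pattern_of /= -sumrB.
apply: le_lt_trans (ler_norm_sum _ _ _) _.
apply: (@le_lt_trans _ _ (k.+1%:R^-1 * \sum_s `|F s|)).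
  rewrite mulr_sumr; apply: ler_sum => s _; rewrite -mulrBl normrM ler_wpM2r //.
  by apply: hN => // y.
have kM : k.+1%:R^-1 * M < e by rewrite -ltr_pdivlMr.
apply: le_lt_trans kM; rewrite ler_wpM2l ?invr_ge0 //.
by rewrite lerDl.
Qed.

Lemma countable_bigcapT_measurable (d' : measure_display) (T : measurableType d')
    (U : countType) (F : U -> set T) :
  (forall i, measurable (F i)) -> measurable (\bigcap_i F i).
Proof.
move=> mF; rewrite -[X in measurable X]setCK setC_bigcap; apply: measurableC.
apply: countable_bigcupT_measurable; first exact: countableP.
by move=> i; exact: measurableC.
Qed.

(* Without this lemma C1 says nothing: the value of a measure on a
   non-measurable set is unconstrained. *)
Lemma measurable_Omega_le0 : measurable (Omega_le0 gamma).
Proof.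
have -> : Omega_le0 gamma = @plusify d E pl @^-1`
   (\bigcap_(l : seq (site d)) \bigcap_n
      \bigcap_(s in [set: {ffun boxn d n -> E}])
      cont_set (fun w' => fine (gamma [set` l] w' (pat s)))).
  apply/seteqP; split=> w; first by move=> /cont_pointP h l _ n _ s _; exact: h.
  by move=> h; apply/cont_pointP => l n s; exact: h.
rewrite -[X in measurable X]setTI; apply: measurable_plusify => //.
apply: (@countable_bigcapT_measurable _ OM (seq 'rV[int]_d)) => l.
apply: bigcap_measurableType => n _; apply: fin_bigcap_measurable; first exact: finite_finset.
by move=> s _; exact: measurable_cont_set.
Qed.

(** The box of radius 0 is the origin alone; in this form [cont_pointP] applies to [gamma0]. *)
Lemma gamma0E a w : gamma0 gamma a w = fine (gamma [set` [:: (0 : site d)]] w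
   (pat ([ffun=> a] : {ffun boxn d 0 -> E}))).
Proof.
have s0 (b : boxn d 0) : site_of b = 0.
  by apply/rowP => i; rewrite !mxE; case: (b i) => -[].
rewrite /gamma0; congr (fine (gamma _ _ _)).
  by apply/seteqP; split=> x /=; rewrite inE => /eqP.
apply/seteqP; split=> w' /=; first by move=> h b; rewrite s0 ffunE.
by move=> /(_ [ffun=> ord0]); rewrite s0 ffunE.
Qed.

Lemma gamma0_ge0 a w : 0 <= gamma0 gamma a w.
Proof. by rewrite /gamma0 fine_ge0. Qed.

Lemma gamma0_le1 a w : gamma0 gamma a w <= 1.
Proof.
rewrite gamma0E -[leRHS]/(fine 1%E) fine_le //.
- exact: fin_num_measure (measurable_patcyl _ _ _ _ _).
- exact: probability_le1 (measurable_patcyl _ _ _ _ _).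
Qed.

Lemma gamma0_dist a w1 w2 : `|gamma0 gamma a w1 - gamma0 gamma a w2| <= 1.
Proof.
have := gamma0_ge0 a w1; have := gamma0_ge0 a w2.
have := gamma0_le1 a w1; have := gamma0_le1 a w2.
by rewrite ler_norml; lra.
Qed.

Definition osc_set N (w : OM) : set R :=
  [set r | exists a w1 w2, [/\ cyl_on (Lam d N) w w1, cyl_on (Lam d N) w w2 &
     r = `|gamma0 gamma a w1 - gamma0 gamma a w2|]].

Definition osc N (w : OM) : R := sup (osc_set N w).

Lemma osc_set_nonempty N w : osc_set N w !=set0.
Proof. by eexists; exists pl, w, w; split. Qed.

Lemma osc_set_ubound N w : ubound (osc_set N w) 1.
Proof. by move=> _ [a [w1 [w2 [_ _ ->]]]]; exact: gamma0_dist. Qed.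

Lemma le_osc N w a w1 w2 : cyl_on (Lam d N) w w1 -> cyl_on (Lam d N) w w2 ->
  `|gamma0 gamma a w1 - gamma0 gamma a w2| <= osc N w.
Proof.
move=> h1 h2; apply: ub_le_sup; last by exists a, w1, w2.
by exists 1; exact: osc_set_ubound.
Qed.

Lemma osc_ge0 N w : 0 <= osc N w.
Proof. exact: le_trans (normr_ge0 _) (le_osc N w pl w w (fun _ _ => erefl) (fun _ _ => erefl)). Qed.

Lemma osc_le1 N w : osc N w <= 1.
Proof. by apply: ge_sup; [exact: osc_set_nonempty|exact: osc_set_ubound]. Qed.

Lemma osc_congr N w w' : cyl_on (Lam d N) w w' -> osc N w = osc N w'.
Proof.
move=> ww'; congr sup; apply/seteqP; split=> r [a [w1 [w2 [h1 h2 ->]]]];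
  exists a, w1, w2; split=> //.
- exact: cyl_on_trans (cyl_on_sym _ _ _ _ _ _ ww') h1.
- exact: cyl_on_trans (cyl_on_sym _ _ _ _ _ _ ww') h2.
- exact: cyl_on_trans ww' h1.
- exact: cyl_on_trans ww' h2.
Qed.

Lemma plusify_cyl_on (L : set (site d)) (w w' : OM) :
  cyl_on L w w' -> cyl_on L (plusify w) (plusify w').
Proof. by move=> h x Lx; rewrite /plusify h. Qed.

(** Although a supremum over an infinite family of pairs, it depends on [w] only through its pattern
    in the box of radius [N]. *)
Lemma measurable_osc N : measurable_fun setT (fun w => osc N (plusify w)).
Proof.
have -> : (fun w => osc N (plusify w)) =
    (fun w => osc N (plusify (config_of N (pattern_of N w)))).
  apply/funext => w; apply: osc_congr; apply: plusify_cyl_on.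
  exact: cyl_on_config_of.
exact: (measurable_fun_pattern_of _ _ _ _ N (fun s => osc N (plusify (config_of N s)))).
Qed.

Lemma osc_norm_le1 N w : `|osc N w| <= 1.
Proof. by rewrite ger0_norm ?osc_ge0 ?osc_le1. Qed.

(** Finiteness of [E] makes one radius serve all spins [a], and a larger radius leaves fewer
    configurations to compare. *)
Lemma cvg_osc (w : OM) : cont_point gamma w -> osc N w @[N --> \oo] --> 0.
Proof.
move=> /cont_pointP cw; apply/cvgrPdistC_le => e e0.
have [k ke] := small_inv _ e0.
have [N hN] : exists N, forall a w1 w2, cyl_on (Lam d N) w w1 ->
     cyl_on (Lam d N) w w2 -> `|gamma0 gamma a w1 - gamma0 gamma a w2| <= k.+1%:R^-1.
  apply: ex_uniform_bound => [a i j ij h w1 w2 h1 h2|a].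
    by apply: h; apply: cyl_on_sub h1 || apply: cyl_on_sub h2; exact: Lam_le.
  have [N hN] := cw [:: 0] 0%N [ffun=> a] k.
  by exists N => w1 w2 h1 h2; rewrite !gamma0E; exact: hN.
exists N => // n /= Nn; rewrite subr0 ger0_norm ?osc_ge0 //.
apply: le_trans (ltW ke); apply: ge_sup; first exact: osc_set_nonempty.
move=> _ [a [w1 [w2 [h1 h2 ->]]]].
by apply: hN; apply: cyl_on_sub h1 || apply: cyl_on_sub h2; exact: Lam_le.
Qed.

(** This is where C1 enters: dominated convergence, with bound 1, on the full-measure set where
    [plusify w] is a continuity point. *)
Lemma cvg_integral_osc (mu : probability OM R) : mu (Omega_le0 gamma) = 1%E ->
  Rintegral mu setT (fun w => osc N (plusify w)) @[N --> \oo] --> 0.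
Proof.
move=> mu1; have mO := measurable_Omega_le0.
have muC : mu (~` Omega_le0 gamma) = 0%E by rewrite probability_setC // mu1 subee.
have int N : mu.-integrable setT (EFin \o (fun w => osc N (plusify w))).
  apply: (bounded_integrable _ _ _ _ mu _ 1); first exact: measurable_osc.
  by move=> w; exact: osc_norm_le1.
have cvgE : (\int[mu]_(w in Omega_le0 gamma) (osc N (plusify w))%:E)%E @[N --> \oo]
    --> (\int[mu]_(w in Omega_le0 gamma) 0%E)%E.
  apply: (@dominated_cvg _ _ _ _ _ mO _ _ (cst 1%E)) => //.
  - by move=> N; apply: measurable_funTS; apply/measurable_EFinP; exact: measurable_osc.
  - by move=> w Ow; apply: cvg_EFin; [exact: nearW|exact: cvg_osc].
  - apply: (@integrableS _ _ _ mu setT) => //.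
    apply: (bounded_integrable _ _ _ _ mu (cst 1) 1) => // w.
    by rewrite normr1.
  - by move=> N w _ /=; rewrite lee_fin osc_norm_le1.
rewrite integral0 in cvgE.
rewrite /Rintegral.
have -> : (fun N => fine (\int[mu]_w (osc N (plusify w))%:E)%E) =
    (fun N => fine (\int[mu]_(w in Omega_le0 gamma) (osc N (plusify w))%:E)%E).
  apply/funext => N; congr fine.
  rewrite (negligible_integral (measurableC mO) measurableT (int N) muC).
  by rewrite setTD setCK.
exact: fine_cvg.
Qed.

End continuity.

(** * Single-site energy steps and convergence of their average *)

Lemma ln_lipschitz (R : realType) (alpha x y : R) : 0 < alpha -> alpha <= x -> alpha <= y ->
  `|ln x - ln y| <= `|x - y| / alpha.
Proof.
move=> a0.
(* By symmetry a one-sided bound is enough; it follows from ln(u/v) being at most u/v - 1. *)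
suff H u v : alpha <= u -> alpha <= v -> ln u - ln v <= `|u - v| / alpha.
  by move=> ax ay; rewrite ler_norml lerNl opprB !H // -normrN opprB H.
move=> au av; have u0 := lt_le_trans a0 au; have v0 := lt_le_trans a0 av.
rewrite -ln_div ?posrE //.
have uv0 : 0 < u / v by rewrite divr_gt0.
apply: (@le_trans _ _ (u / v - 1)).
  have := @le_ln1Dx R (u / v - 1); rewrite subrKC; apply.
  by rewrite ltrBrDl subrr.
have -> : u / v - 1 = (u - v) / v by rewrite mulrBl divff // gt_eqF.
apply: (@le_trans _ _ (`|u - v| / v)).
  by rewrite ler_wpM2r ?invr_ge0 ?(ltW v0) // ler_norm.
by rewrite ler_wpM2l // lef_pV2 ?posrE.
Qed.

Section energy.
Variables (d : nat) (E : finType) (pl : E) (R : realType).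
Local Notation OM := (Omega d pl).
Local Notation pat := (@patcyl d E pl _).
Variable gamma : kernel_fam d pl R.
Hypothesis spec : is_specification gamma.

Lemma measurable_kernel (L : set (site d)) (A : set OM) :
  finite_set L -> measurable A -> measurable_fun setT (fun w => gamma L w A).
Proof.
move=> fL mA _ B mB; rewrite setTI; apply: (@sF_measurable _ _ _ (~` L)).
by have [+ _] := spec; exact.
Qed.

Lemma measurable_gamma0 a : measurable_fun setT (gamma0 gamma a).
Proof.
apply: (measurableT_comp (f := fine)); first exact: fine_measurable.
by apply: measurable_kernel; [exact: finite_set1|exact: measurable_coord].
Qed.

Lemma gamma0_lower_bound : exists alpha : R, 0 < alpha /\
  forall a w, alpha <= gamma0 gamma a w.
Proof.
have [_ [_ [_ nonnull]]] := spec.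
have [||alpha [b [a0 [_ h]]]] := nonnull [set (0 : site d)].
- exact: finite_set1.
- by exists 0.
exists alpha; split=> // a w; have /andP[h1 _] := h (fun=> a) w.
have e : cyl_on [set (0 : site d)] ((fun=> a) : OM) = [set w' : OM | w' 0 = a].
  by apply/seteqP; split=> w'; [exact|move=> k _ ->].
rewrite e in h1; rewrite /gamma0 -lee_fin fineK //.
by apply: fin_num_measure; exact: measurable_coord.
Qed.

(** The level set of the kernel through [w] is measurable with respect to the spins off the origin,
    hence determined by them. *)
Lemma gamma0_off0 a (w w' : OM) : cyl_on (~` [set 0]) w w' ->
  gamma0 gamma a w = gamma0 gamma a w'.
Proof.
move=> ww'; have [ms _] := spec.
pose v := gamma [set 0] w [set z : OM | z 0 = a].
have mv : measurable [set v] by exact: emeasurable_set1.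
have /sF_determined h := ms [set 0] (finite_set1 _) _ (measurable_coord _ _ _ 0 a) _ mv.
by rewrite /gamma0 (h w w' ww' erefl).
Qed.

(** The Gibbs property with the whole space as conditioning event writes this mass as a mean of
    kernel values, all above the nonnullness constant. *)
Lemma nonnull_cyl (nu : probability OM R) n (w : OM) : is_gibbs gamma nu ->
  0 < fine (nu (cyl_on (Lam d n) w)).
Proof.
move=> gib; have [_ [_ [_ nonnull]]] := spec.
have fL := finite_Lam d n.
have [|a [b [a0 [_ h]]]] := nonnull _ fL.
  by exists 0 => i; rewrite mxE normr0.
have mc := measurable_cyl_on _ _ _ _ w fL.
have sT : sF (~` Lam d n) (setT : set OM).
  have := @smallest_sigma_algebra _ setT (@cylgen d E pl (~` Lam d n)).
  by case=> s0 sC _; rewrite -[setT]setD0; exact: sC.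
have e := gib _ fL _ mc _ sT; rewrite setIT in e.
have : (a%:E <= nu (cyl_on (Lam d n) w))%E.
  rewrite e -[leLHS]mule1 -(@probability_setT _ _ _ nu) -integral_cst //.
  apply: ge0_le_integral => //.
  - by move=> *; rewrite lee_fin ltW.
  - exact: measurable_kernel.
  - by move=> z _; have /andP[] := h w z.
move=> h'; rewrite (lt_le_trans a0) // -lee_fin fineK //.
exact: fin_num_measure.
Qed.

Hypothesis tinv : spec_translation_invariant gamma.

Lemma gamma_shift x a (w : OM) :
  gamma [set x] w [set w' : OM | w' x = a] = (gamma0 gamma a (tau x w))%:E.
Proof.
have e0 : [set y + x | y in [set (0 : site d)]] = [set x] by rewrite image_set1 add0r.
have e1 : @tau d E pl x @` [set w' : OM | w' x = a] = [set w' : OM | w' 0 = a].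
  apply/seteqP; split=> [_ [z zx <-]|z z0 /=]; first by rewrite /tau /= addr0.
  exists (fun y => z (y - x)); first by rewrite /= subrr.
  by apply/funext => y; rewrite /tau addrAC subrr add0r.
rewrite -{1}e0 tinv ?e1; [|exact: finite_set1|exact: measurable_coord].
by rewrite /gamma0 fineK //; apply: fin_num_measure; exact: measurable_coord.
Qed.

Definition upd (w : OM) (x : site d) (a : E) : OM := fun y => if y == x then a else w y.

Variable nu : probability OM R.
Hypothesis gib : is_gibbs gamma nu.

(** The cylinder is the event of spin [a] at [x] intersected with a cylinder off [x]; apply the
    Gibbs property at the single site [x] and shift the kernel to the origin. *)
Lemma cyl_upd_Rintegral n x (w : OM) a : Lam d n x ->
  fine (nu (cyl_on (Lam d n) (upd w x a))) =
  Rintegral nu (cyl_on (Lam d n `\ x) w) (fun z => gamma0 gamma a (tau x z)).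
Proof.
move=> Lx; set C := cyl_on _ w.
have sC : sF (~` [set x]) C.
  apply: sF_cyl_on; first by apply: finite_setD; exact: finite_Lam.
  by move=> y [].
have -> : cyl_on (Lam d n) (upd w x a) = [set z : OM | z x = a] `&` C.
  apply/seteqP; split=> z.
    move=> h; split; first by rewrite /= h // /upd eqxx.
    by move=> y [Ly /eqP yx]; rewrite h // /upd (negbTE yx).
  move=> [/= zx zC] y Ly; rewrite /upd; case: eqP => [->//|yx].
  by apply: zC; split.
rewrite (gib _ (finite_set1 x) _ (measurable_coord _ _ _ x a) _ sC) /Rintegral.
by congr fine; apply: eq_integral => z _; rewrite gamma_shift.
Qed.

(** The quotient q / c is an average of [gamma0] over the cylinder off [x], so it is at least
    [alpha] and within [V] of [g]; the Lipschitz bound for ln concludes. *)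
Lemma ln_cyl_upd_approx alpha n x (w : OM) a V g : Lam d n x ->
  0 < alpha -> (forall w', alpha <= gamma0 gamma a w') -> alpha <= g ->
  (forall z, cyl_on (Lam d n `\ x) w z -> `|gamma0 gamma a (tau x z) - g| <= V) ->
  `|ln (fine (nu (cyl_on (Lam d n) (upd w x a))))
    - ln (fine (nu (cyl_on (Lam d n `\ x) w))) - ln g| <= V / alpha.
Proof.
move=> Lx a0 ga gg hV.
have q0 := nonnull_cyl nu n (upd w x a) gib.
have qE := cyl_upd_Rintegral n x w a Lx.
move: q0 qE; set q := fine _; set C := cyl_on (_ `\ _) _; set c := fine (nu C) => q0 qE.
have mC : measurable C by apply: measurable_cyl_on; apply: finite_setD; exact: finite_Lam.
have int : nu.-integrable C (EFin \o (fun z => gamma0 gamma a (tau x z))).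
  apply: (@integrableS _ _ _ nu setT) => //; apply: (bounded_integrable _ _ _ _ nu _ 1).
    apply: (measurableT_comp (f := gamma0 gamma a)); first exact: measurable_gamma0.
    exact: measurable_tau.
  by move=> z; rewrite ger0_norm ?gamma0_ge0 ?gamma0_le1.
have intc r : nu.-integrable C (EFin \o cst r).
  apply: (@integrableS _ _ _ nu setT) => //.
  exact: (bounded_integrable _ _ _ _ nu (cst r) `|r|).
have ub r : (forall z, C z -> gamma0 gamma a (tau x z) <= r) -> q <= r * c.
  move=> h; rewrite qE -(Rintegral_cst nu mC r).
  exact: (le_Rintegral mC int (intc r)).
have lb r : (forall z, C z -> r <= gamma0 gamma a (tau x z)) -> r * c <= q.
  move=> h; rewrite qE -(Rintegral_cst nu mC r).
  exact: (le_Rintegral mC (intc r) int).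
(* Since kernel values are at most 1, [q] is at most [c], and [q] is positive. *)
have c0 : 0 < c.
  by apply: lt_le_trans q0 _; rewrite -[leRHS]mul1r; apply: ub => z _; exact: gamma0_le1.
have l1 : alpha * c <= q by exact: lb.
have l2 : q <= (g + V) * c.
  by apply: ub => z /hV; rewrite ler_norml => /andP[_]; lra.
have l3 : (g - V) * c <= q.
  by apply: lb => z /hV; rewrite ler_norml => /andP[+ _]; lra.
rewrite -ln_div ?posrE //.
apply: le_trans (ln_lipschitz _ _ _ _ a0 _ gg) _; first by rewrite ler_pdivlMr.
rewrite ler_wpM2r ?invr_ge0 ?(ltW a0) // ler_norml.
have k2 : q / c <= g + V by rewrite ler_pdivrMr.
have k3 : g - V <= q / c by rewrite ler_pdivlMr.
by lra.
Qed.

(** The cost of turning the spin at [b] from plus into [s b], when earlier sites already follow [s]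
    and later ones are still plus. *)
Definition energy_step n (b : boxn d n) (s : {ffun boxn d n -> E}) : R :=
  ln (fine (nu (pat [ffun c => if ~~ blt d n b c then s c else pl]))) -
  ln (fine (nu (pat [ffun c => if blt d n c b then s c else pl]))).

Lemma sum_energy_step n (s : {ffun boxn d n -> E}) :
  \sum_b energy_step n b s =
  ln (fine (nu (pat s))) - ln (fine (nu (pat (plus_pat d pl n)))).
Proof.
pose G (S : {set boxn d n}) : R :=
  ln (fine (nu (pat [ffun c => if c \in S then s c else pl]))).
have := telescope_order _ (@blt d n) (@blt_irr d n) (@blt_trans d n) (@blt_total d n) _ G.
have -> : G finset.setT = ln (fine (nu (pat s))).
  by congr (ln (fine (nu (pat _)))); apply/ffunP => c; rewrite ffunE finset.in_setT.
have -> : G finset.set0 = ln (fine (nu (pat (plus_pat d pl n)))).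
  by congr (ln (fine (nu (pat _)))); apply/ffunP => c; rewrite !ffunE finset.in_set0.
move=> <-; apply: eq_bigr => b _; congr (_ - _); congr (ln (fine (nu (pat _))));
  by apply/ffunP => c; rewrite !ffunE finset.in_set.
Qed.

Lemma energy_integrand_lnB (w : OM) alpha : 0 < alpha ->
  (forall a w', alpha <= gamma0 gamma a w') ->
  energy_integrand gamma w =
    ln (gamma0 gamma (w 0) (plusify w)) - ln (gamma0 gamma pl (plusify w)).
Proof.
move=> a0 ga; rewrite /energy_integrand ln_div ?posrE ?(lt_le_trans a0) //.
rewrite /plusify; case: asboolP => // /lexlt_irr [].
Qed.

(** Both cylinders of the step are updates at [b] of one configuration, so the mass of the cylinder
    off [b] cancels. Each of the two remaining logarithms costs [V / alpha]. *)
Lemma energy_step_approx alpha n (b : boxn d n) (w : OM) V : 0 < alpha ->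
  (forall a w', alpha <= gamma0 gamma a w') ->
  (forall a z, (forall y, Lam d n (site_of b + y) -> y <> 0 -> z y = plusify (tau (site_of b) w) y) ->
     `|gamma0 gamma a z - gamma0 gamma a (plusify (tau (site_of b) w))| <= V) ->
  `|energy_step n b (pattern_of n w) - energy_integrand gamma (tau (site_of b) w)|
    <= 2 * V / alpha.
Proof.
move=> a0 ga hV; set x := site_of b in hV *.
(* Equal to [w] up to and including [x] and to plus afterwards; seen from [x] it is the plusified
   shift of [w]. *)
pose eta : OM := fun z => if `[< lexlt x z >] then pl else w z.
have etaE y : eta (x + y) = plusify (tau x w) y.
  rewrite /eta /plusify /tau.
  by have -> : `[< lexlt x (x + y) >] = `[< lexlt 0 y >] by apply: asbool_equiv_eq; exact: lexlt_add0.
have Lx : Lam d n x by exact: Lam_site_of.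
have hC a z : cyl_on (Lam d n `\ x) eta z ->
    `|gamma0 gamma a (tau x z) - gamma0 gamma a (plusify (tau x w))| <= V.
  move=> zC; apply: hV => y Ly y0; rewrite -etaE /tau zC //; split=> //= h.
  by apply: y0; apply: (addrI x); rewrite addr0.
have apx a := ln_cyl_upd_approx alpha n x eta a V _ Lx a0 (ga a) (ga a _) (hC a).
have s1 : pat [ffun c => if ~~ blt d n b c then pattern_of n w c else pl] =
    cyl_on (Lam d n) (upd eta x (w x)).
  rewrite -patcyl_pattern_of; congr patcyl; apply/ffunP => c; rewrite !ffunE /upd.
  case: eqP => [/site_of_inj ->|_]; first by rewrite blt_irr.
  by rewrite /eta /blt; case: asboolP.
have s2 : pat [ffun c => if blt d n c b then pattern_of n w c else pl] =
    cyl_on (Lam d n) (upd eta x pl).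
  rewrite -patcyl_pattern_of; congr patcyl; apply/ffunP => c; rewrite !ffunE /upd.
  case: eqP => [/site_of_inj ->|cx]; first by rewrite blt_irr.
  rewrite /eta /blt -/x; case: asboolP => h; case: asboolP => k //.
    by have /lexlt_irr := lexlt_trans _ _ _ _ h k.
  by case: (lexlt_total _ _ _ cx).
rewrite /energy_step s1 s2 (energy_integrand_lnB _ alpha) //.
have -> : tau x w 0 = w x by rewrite /tau addr0.
have := apx (w x); have := apx pl.
set A1 := ln _; set A2 := ln _; set A3 := ln _; set A4 := ln _; set A5 := ln _ => p1 p2.
have -> : A4 - A1 - (A5 - A3) = (A4 - A2 - A5) - (A1 - A2 - A3) by ring.
apply: le_trans (ler_normB _ _) _.
have -> : 2 * V / alpha = V / alpha + V / alpha by ring.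
exact: lerD.
Qed.

Variable mu : probability OM R.
Hypothesis invmu : translation_invariant mu.
Hypothesis C1 : mu (Omega_le0 gamma) = 1%E.

Lemma energy_integrand_bound alpha : 0 < alpha ->
  (forall a w', alpha <= gamma0 gamma a w') ->
  forall w, `|energy_integrand gamma w| <= alpha^-1.
Proof.
move=> a0 ga w; rewrite (energy_integrand_lnB _ alpha) //.
apply: le_trans (ln_lipschitz _ alpha _ _ a0 _ _) _ => //.
rewrite ler_piMl ?invr_ge0 ?(ltW a0) // ler_norml.
have := gamma0_ge0 d E pl R gamma (w 0) (plusify w).
have := gamma0_ge0 d E pl R gamma pl (plusify w).
have := gamma0_le1 d E pl R gamma (w 0) (plusify w).
have := gamma0_le1 d E pl R gamma pl (plusify w).
by lra.
Qed.

Lemma measurable_energy_integrand : measurable_fun setT (energy_integrand gamma).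
Proof.
have [alpha [a0 ga]] := gamma0_lower_bound.
pose h a (w : OM) := ln (gamma0 gamma a (plusify w)) - ln (gamma0 gamma pl (plusify w)).
have mh a : measurable_fun setT (h a).
  have ml c : measurable_fun setT (fun w : OM => ln (gamma0 gamma c (plusify w))).
    apply: (measurableT_comp (f := @ln R)); first exact: measurable_ln.
    apply: (measurableT_comp (f := gamma0 gamma c)); first exact: measurable_gamma0.
    exact: measurable_plusify.
  exact: measurable_funB.
move=> _ B mB; rewrite setTI.
(* The spin whose probability is taken varies with [w]; splitting by the value of [w 0] fixes it. *)
have -> : energy_integrand gamma @^-1` B =
    \bigcup_(a in [set: E]) ([set w | w 0 = a] `&` (h a @^-1` B)).
  apply/seteqP; split=> [w Bw|w [a _ [/= wa]]].
    exists (w 0) => //; split => //=; rewrite /h -(energy_integrand_lnB _ alpha) //.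
  by rewrite /h -wa -(energy_integrand_lnB _ alpha).
apply: fin_bigcup_measurable; first exact: finite_finset.
move=> a _; apply: measurableI; first exact: measurable_coord.
by rewrite -[X in measurable X]setTI; exact: mh.
Qed.

Lemma cvg_energy_average :
  (cardL R d n)^-1 * \sum_(s : {ffun boxn d n -> E}) fine (mu (pat s)) *
    (ln (fine (nu (pat s))) - ln (fine (nu (pat (plus_pat d pl n))))) @[n --> \oo]
  --> Rintegral mu setT (energy_integrand gamma).
Proof.
have [alpha [a0 ga]] := gamma0_lower_bound.
have phi_bound := energy_integrand_bound alpha a0 ga.
have mphi := measurable_energy_integrand.
pose u n (b : boxn d n) := Rintegral mu setT (fun w => energy_step n b (pattern_of n w)).
have -> : (fun n => (cardL R d n)^-1 * \sum_(s : {ffun boxn d n -> E}) fine (mu (pat s)) *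
    (ln (fine (nu (pat s))) - ln (fine (nu (pat (plus_pat d pl n)))))) =
  (fun n => (cardL R d n)^-1 * \sum_b u n b).
  apply/funext => n; congr (_ * _); rewrite /u.
  under [RHS]eq_bigr do rewrite Rintegral_pattern_of.
  rewrite exchange_big /=; apply: eq_bigr => s _.
  by rewrite -mulr_sumr sum_energy_step.
(* Invariance of [mu] moves both integrals back to the origin, so a pointwise error [V] seen from
   [b] becomes its mean. It is used below with the constant 1 for all sites and with the oscillation
   for bulk sites. *)
have ub n (b : boxn d n) (V : OM -> R) : measurable_fun setT V ->
    (forall w, `|V w| <= 1) ->
    (forall w, `|energy_step n b (pattern_of n w) - energy_integrand gamma (tau (site_of b) w)|
      <= 2 * V (tau (site_of b) w) / alpha) ->
    `|u n b - Rintegral mu setT (energy_integrand gamma)| <=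
      2 / alpha * Rintegral mu setT V.
  move=> mV V1 hV.
  have mt := measurable_tau d E pl (site_of b).
  have i1 : mu.-integrable setT (EFin \o (fun w : OM => energy_step n b (pattern_of n w))).
    exact: (integrable_pattern_of _ _ _ _ mu n (energy_step n b)).
  have i2 : mu.-integrable setT (EFin \o (fun w : OM => energy_integrand gamma (tau (site_of b) w))).
    apply: (bounded_integrable _ _ _ _ mu _ alpha^-1) => //.
    exact: measurableT_comp.
  have i3 : mu.-integrable setT (EFin \o (fun w : OM => V (tau (site_of b) w))).
    by apply: (bounded_integrable _ _ _ _ mu _ 1) => //; exact: measurableT_comp.
  have i4 : mu.-integrable setT (EFin \o (fun w : OM => 2 / alpha * V (tau (site_of b) w))).
    have := integrableZl measurableT (2 / alpha) i3.
    by apply: eq_integrable.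
  rewrite -(Rintegral_tau _ _ _ _ mu (site_of b) _ _ invmu mphi phi_bound).
  rewrite -(Rintegral_tau _ _ _ _ mu (site_of b) _ _ invmu mV V1).
  rewrite /u -RintegralB // -RintegralZl //.
  have i5 : mu.-integrable setT (EFin \o (fun w : OM => energy_step n b (pattern_of n w) -
      energy_integrand gamma (tau (site_of b) w))).
    have := integrableB measurableT i1 i2.
    by apply: eq_integrable.
  apply: le_trans (le_normr_Rintegral _ i5) _ => //.
  apply: le_Rintegral => //.
    by apply: eq_integrable (integrable_abse i5).
  by move=> w _; apply: le_trans (hV w) _; rewrite mulrAC.
have cosc := cvg_integral_osc _ _ _ _ gamma mu C1.
apply: (cvg_box_average _ _ _ _ (2 / alpha) (fun N => 2 / alpha *
   Rintegral mu setT (fun w => osc _ _ _ _ gamma N (plusify w)))).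
- move=> n b; have i1 : Rintegral mu setT (cst 1) <= 1.
    rewrite Rintegral_cst // mul1r -[leRHS]/(fine 1%E).
    by rewrite fine_le ?probability_le1 //; exact: fin_num_measure.
  rewrite -[leRHS]mulr1; apply: le_trans (ub n b (cst 1) _ _ _) _ => //.
  + by move=> w; rewrite normr1.
  + by move=> w; apply: energy_step_approx => // a z _; exact: gamma0_dist.
  + by rewrite ler_wpM2l // divr_ge0 // ltW.
- rewrite -[X in _ --> X](mulr0 (2 / alpha)); apply: cvgMr; exact: cosc.
- move=> N n b hb; apply: ub => [|w|w]; [exact: measurable_osc|exact: osc_norm_le1|].
  apply: energy_step_approx => // a z hz.
  set p := plusify _ in hz *.
  (* [z] is known to match [p] only off the origin. Resetting its spin there leaves the kernel
     unchanged and puts it in the range of the oscillation. *)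
  rewrite -(gamma0_off0 a (upd z 0 (p 0)) z); last first.
    by move=> y /= /eqP y0; rewrite /upd (negbTE y0).
  apply: le_osc => // y Ny; rewrite /upd; case: eqP => [->//|y0].
  by apply: hz => //; exact: hb.
Qed.

End energy.

(** * Decomposition of the relative entropy and conclusion *)

Lemma relent_n_decomposition (d : nat) (E : finType) (pl : E) (R : realType)
    (mu nu : probability (Omega d pl) R) n :
  (forall s : {ffun boxn d n -> E}, 0 < fine (nu (@patcyl d E pl n s))) ->
  relent_n mu nu n = - ks_n mu n + energy_n nu n -
    (cardL R d n)^-1 * \sum_(s : {ffun boxn d n -> E}) fine (mu (@patcyl d E pl n s)) *
      (ln (fine (nu (@patcyl d E pl n s))) -
       ln (fine (nu (@patcyl d E pl n (plus_pat d pl n))))).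
Proof.
move=> nu0; rewrite /relent_n /ks_n /energy_n opprK.
set N := ln (fine (nu (patcyl (plus_pat d pl n)))).
have -> : \sum_(s : {ffun boxn d n -> E}) fine (mu (@patcyl d E pl n s)) *
    (ln (fine (nu (@patcyl d E pl n s))) - N) =
  \sum_(s : {ffun boxn d n -> E}) fine (mu (@patcyl d E pl n s)) *
    ln (fine (nu (@patcyl d E pl n s))) - N.
  under eq_bigr do rewrite mulrBr.
  rewrite sumrB -mulr_suml; congr (_ - _).
  by have := sum_pweight d E pl R mu n; rewrite /pweight => ->; rewrite mul1r.
have -> : \sum_(s : {ffun boxn d n -> E}) fine (mu (@patcyl d E pl n s)) *
    ln (fine (mu (@patcyl d E pl n s)) / fine (nu (@patcyl d E pl n s))) =
  \sum_(s : {ffun boxn d n -> E}) fine (mu (@patcyl d E pl n s)) * ln (fine (mu (@patcyl d E pl n s)))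
  - \sum_(s : {ffun boxn d n -> E}) fine (mu (@patcyl d E pl n s)) * ln (fine (nu (@patcyl d E pl n s))).
  rewrite -sumrB; apply: eq_bigr => s _.
  (* The logarithm of the quotient splits only where [mu] charges the pattern; elsewhere the factor
     0 removes both sides. *)
  have [->|m0] := eqVneq (fine (mu (@patcyl d E pl n s))) 0; first by rewrite !mul0r subrr.
  by rewrite ln_div ?posrE ?mulrBr // lt0r m0 fine_ge0.
by ring.
Qed.

Theorem theorem3p3 (d : nat) (E : finType) (pl : E) (R : realType)
    (gamma : set (site d) -> Omega d pl -> probability (Omega d pl) R)
    (nu mu : probability (Omega d pl) R) :
  is_specification gamma ->
  spec_translation_invariant gamma ->
  is_gibbs gamma nu -> translation_invariant nu ->
  translation_invariant mu ->
  mu (Omega_le0 gamma) = 1%E ->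
  (* (1) *)
  ((exists h : R, relent_n mu nu n @[n --> \oo] --> h) <->
   (exists e : R, energy_n nu n @[n --> \oo] --> e)) /\
  (forall h e : R, relent_n mu nu n @[n --> \oo] --> h -> energy_n nu n @[n --> \oo] --> e ->
     exists hmu : R, ks_n mu n @[n --> \oo] --> hmu /\
       h = - hmu + e - Rintegral mu setT (energy_integrand gamma)) /\
  (* (2) *)
  (is_gibbs gamma mu -> forall e : R, energy_n nu n @[n --> \oo] --> e ->
     exists h : R, relent_n mu nu n @[n --> \oo] --> h /\ ratio_n mu nu n @[n --> \oo] --> h).
Proof.
move=> spec tinv gib _ invmu C1.
have pos P n (s : {ffun boxn d n -> E}) : is_gibbs gamma P ->
    0 < fine (P (@patcyl d E pl n s)).
  move=> gP; have := nonnull_cyl _ _ _ _ gamma spec P n (config_of n s) gP.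
  by rewrite -patcyl_pattern_of config_ofK.
have [hmu cks] := cvg_ks_n d E pl R mu invmu.
set I := Rintegral mu setT (energy_integrand gamma).
have dec P n (gP : is_gibbs gamma P) :=
  relent_n_decomposition d E pl R mu P n (fun s => pos P n s gP).
(* Stated, like [bwd], for any Gibbs measure [P], so that part (2) can take [P] to be [mu] as well
   as [nu]. *)
have fwd P e : is_gibbs gamma P -> energy_n P n @[n --> \oo] --> e ->
    relent_n mu P n @[n --> \oo] --> - hmu + e - I.
  move=> gP ce; rewrite (eq_cvg _ _ (fun n => dec P n gP)).
  by apply: cvgB; [apply: cvgD => //; exact: cvgN|exact: cvg_energy_average].
have bwd P h : is_gibbs gamma P -> relent_n mu P n @[n --> \oo] --> h ->
    energy_n P n @[n --> \oo] --> h + hmu + I.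
  (* By the decomposition this is the energy average, so it converges and the energy can be solved
     for. *)
  move=> gP ch; pose avg n := - ks_n mu n + energy_n P n - relent_n mu P n.
  have cavg : avg n @[n --> \oo] --> I.
    have avgE n : avg n = (cardL R d n)^-1 *
        \sum_(s : {ffun boxn d n -> E}) fine (mu (@patcyl d E pl n s)) *
        (ln (fine (P (@patcyl d E pl n s))) -
         ln (fine (P (@patcyl d E pl n (plus_pat d pl n))))).
      by rewrite /avg dec // subKr.
    by rewrite (eq_cvg _ _ avgE); exact: cvg_energy_average.
  have eE n : energy_n P n = relent_n mu P n + ks_n mu n + avg n by rewrite /avg; ring.
  by rewrite (eq_cvg _ _ eE); apply: cvgD => //; exact: cvgD.
split; [split=> [[h]|[e]]|split].
- by move=> /(bwd _ _ gib) ch; exists (h + hmu + I).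
- by move=> /(fwd _ _ gib) ce; exists (- hmu + e - I).
- move=> h e ch ce; exists hmu; split=> //.
  by apply: cvg_unique ch (fwd _ _ gib ce); exact: norm_hausdorff.
- move=> gmu e ce; exists (- hmu + e - I); split; first exact: fwd.
  have c0 : relent_n mu mu n @[n --> \oo] --> (0 : R).
    have -> : relent_n mu mu = cst 0; last exact: cvg_cst.
    apply/funext => n; rewrite /relent_n big1 ?mulr0 // => s _.
    by rewrite divff ?ln1 ?mulr0 // gt_eqF // pos.
  (* The vanishing relative entropy of [mu] with respect to itself identifies the plus energy of
     [mu] as [hmu + I]; the log ratio is then a difference of two convergent energies. *)
  have cmu := bwd _ _ gmu c0; rewrite add0r in cmu.
  have -> : - hmu + e - I = e - (hmu + I) by ring.
  have rE n : ratio_n mu nu n = energy_n nu n - energy_n mu n.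
    by rewrite /ratio_n /energy_n ln_div ?posrE ?pos //; ring.
  by rewrite (eq_cvg _ _ rE); exact: cvgB.
Qed.
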